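(* Let $(X_i,d_i,\mathfrak m_i,p_i)$, $i\in\mathbb N\cup\{\infty\}$, be pointed Polish metric measure spaces with boundedly finite measures. Then $(X_i,d_i,\mathfrak m_i,p_i)\to(X_\infty,d_\infty,\mathfrak m_\infty,p_\infty)$ in the weak pointed measured Gromov--Hausdorff sense if and only if $(X_i,d_i,\mathfrak m_i,p_i)\to(X_\infty,d_\infty,\mathfrak m_\infty,p_\infty)$ in the pointed measured Gromov sense.
   Context: $B(x,r)$ is the open ball; $A^r:=\{x:{\rm dist}(x,A)<r\}$. A Polish metric measure space is a complete separable metric space with a Borel measure; pointed means a point is chosen; boundedly finite means the measure is finite on balls. $C_{bbs}(X)$ is the set of bounded continuous functions $X\to\mathbb R$ with bounded support. Weak $(R,\varepsilon)$-approximation ($0<\varepsilon<R$) from $(X,d_X,\mathfrak m_X,p_X)$ to $(Y,d_Y,\mathfrak m_Y,p_Y)$: a Borel map $\psi\colon B(p_X,R)\to Y$ with $\psi(p_X)=p_Y$ for which there is a Borel set $\tilde X\subset B(p_X,R)$ containing $p_X$ with (1) $|d_X(x,y)-d_Y(\psi(x),\psi(y))|\le\varepsilon$ for all $x,y\in\tilde X$; (2) $\mathfrak m_X(B(p_X,R)\setminus\tilde X)\le\varepsilon$ and $\mathfrak m_Y\big(B(p_Y,R-\varepsilon)\setminus\psi(\tilde X)^\varepsilon\big)\le\varepsilon$. Weak pointed measured Gromov--Hausdorff (wpmGH) convergence: there are $R_i\nearrow+\infty$, $\varepsilon_i\searrow0$ and weak $(R_i,\varepsilon_i)$-approximations $\psi_i$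 from $X_i$ to $X_\infty$ with $(\psi_i)_*\mathfrak m_i\rightharpoonup\mathfrak m_\infty$ in duality with $C_{bbs}(X_\infty)$, i.e. $\int_{B(p_i,R_i)}\varphi\circ\psi_i\,d\mathfrak m_i\to\int\varphi\,d\mathfrak m_\infty$ for all $\varphi\in C_{bbs}(X_\infty)$. Pointed measured Gromov (pmG) convergence: there are a Polish (complete separable) metric space $(Y,d)$ and isometric embeddings $\iota_i\colon X_i\to Y$, $i\in\mathbb N\cup\{\infty\}$, such that $d(\iota_i(p_i),\iota_\infty(p_\infty))\to0$ and $(\iota_i)_*\mathfrak m_i\rightharpoonup(\iota_\infty)_*\mathfrak m_\infty$ in duality with $C_{bbs}(Y)$.
   Formalization: Weak pmGH convergence is taken to require the weak (R_i, ε_i)-approximations ψ_i only for all sufficiently large i; required for every i, the equivalence fails (X_0 the line with 100 times Lebesgue measure, all other spaces a point with zero measure). *)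

(* Defs.v *)
From HB Require Import structures.
From mathcomp Require Import all_boot all_order all_algebra.
From mathcomp Require Import all_classical all_reals all_analysis.

Set Implicit Arguments.
Unset Strict Implicit.
Unset Printing Implicit Defensive.

Import Order.TTheory GRing.Theory Num.Theory.
Import numFieldNormedType.Exports.

Local Open Scope classical_set_scope.
Local Open Scope ring_scope.

HB.mixin Record Topological_isSeparable T & Topological T := {
  separable : exists2 D : set T, countable D & dense D
}.

(* [Complete] and the measurable structures of the library come with a
   distinguished element [point]. It only records that the type is inhabited
   and is unrelated to the base point of a pointed space below. *)
#[short(type="polishMetricType")]
HB.structure Definition PolishMetric (R : realType) :=
  { T of Metric R T & Complete T & Topological_isSeparable T }.

(* The set T with its Borel sigma-algebra. *)
Notation borel T := (g_sigma_algebraType (@open T)).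

Record pmmSpace (R : realType) := PMMSpace {
  pmm_carrier :> polishMetricType R ;
  pmm_measure : {measure set (borel pmm_carrier) -> \bar R} ;
  pmm_base : pmm_carrier
}.

Arguments pmm_measure {R} p.
Arguments pmm_base {R} p.

Section Definitions.
Variable R : realType.

Definition boundedly_finite (X : pmmSpace R) : Prop :=
  forall (x : X) (r : R), (pmm_measure X (ball x r) < +oo)%E.

Definition enlargement (X : polishMetricType R) (A : set X) (r : R) : set X :=
  [set x | (edist_inf A x < r%:E)%E].

Lemma edistE (X : polishMetricType R) (x y : X) :
  edist (x, y) = (mdist x y)%:E.
Proof.
apply/eqP; rewrite eq_le; apply/andP; split; last first.
  apply: le_ereal_inf_tmp => _ [r [r0 +] <-].
  by rewrite /= ballEmdist /= lee_fin => /ltW.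
apply/lee_addgt0Pr => e e0; rewrite -EFinD.
apply: edist_fin; first by rewrite addrC ltr_wpDr// mdist_ge0.
by rewrite /= ballEmdist /= ltrDl.
Qed.

Lemma enlargementP (X : polishMetricType R) (A : set X) (r : R) (x : X) :
  enlargement A r x <-> exists2 a, A a & mdist x a < r.
Proof.
rewrite /enlargement /=; split=> [/ereal_inf_lt[_ [a Aa <-]]|[a Aa xar]].
  by rewrite edistE lte_fin => xar; exists a.
apply: (@le_lt_trans _ _ (edist (x, a))); last by rewrite edistE lte_fin.
by apply: ereal_inf_lbound; exists a.
Qed.

Definition metric_bounded (X : polishMetricType R) (A : set X) : Prop :=
  exists (x : X) (r : R), A `<=` ball x r.

(* C_bbs(X) *)
Definition Cbbs (X : polishMetricType R) : set (X -> R) :=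
  [set phi | [/\ continuous phi, bounded_fun phi &
                 metric_bounded (closure [set x | phi x != 0])]].

Definition isometric_embedding (X Y : polishMetricType R) (f : X -> Y) : Prop :=
  forall x y : X, mdist (f x) (f y) = mdist x y.

(* A map defined on B(p_X, r) is represented by a total function psi; its
   values outside of the ball are never used. *)
Definition weak_approximation (X Y : pmmSpace R) (r e : R) (psi : X -> Y)
    : Prop :=
  [/\ 0 < e < r,
      measurable_fun (ball (pmm_base X) r : set (borel X))
                     (psi : borel X -> borel Y),
      psi (pmm_base X) = pmm_base Y &
      exists A : set (borel X),
        [/\ measurable A,
            A `<=` ball (pmm_base X) r,
            A (pmm_base X),
            (forall x y : X, A x -> A y ->
               `|mdist x y - mdist (psi x) (psi y)| <= e) &
            (pmm_measure X (ball (pmm_base X) r `\` A) <= e%:E)%E /\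
            (pmm_measure Y (ball (pmm_base Y) (r - e) `\`
                            enlargement (psi @` A) e) <= e%:E)%E]].

(* Weak convergence in duality with C_bbs(Y). *)
Definition weak_cvg_bbs (Y : polishMetricType R)
    (mu : nat -> set (borel Y) -> \bar R) (nu : set (borel Y) -> \bar R)
    : Prop :=
  forall phi : Y -> R, Cbbs phi ->
    (\int[mu i]_y (phi y)%:E)%E @[i --> \oo] --> (\int[nu]_y (phi y)%:E)%E.

(* The approximations are required for all large i only: convergence must not
   depend on finitely many terms, whereas a given X_i need not admit any weak
   (r, e)-approximation to Xoo with 0 < e < r. For instance there is none from
   the real line with 100 times the Lebesgue measure to a one-point space. *)
Definition wpmGH_cvg (X : nat -> pmmSpace R) (Xoo : pmmSpace R) : Prop :=
  exists (r e : nat -> R) (psi : forall i, X i -> Xoo),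
    [/\ nondecreasing_seq r /\ r i @[i --> \oo] --> +oo,
        nonincreasing_seq e /\ e i @[i --> \oo] --> 0,
        \forall i \near \oo, weak_approximation (r i) (e i) (psi i) &
        forall phi : Xoo -> R, Cbbs phi ->
          (\int[pmm_measure (X i)]_(x in ball (pmm_base (X i)) (r i))
              (phi (psi i x))%:E)%E @[i --> \oo]
          --> (\int[pmm_measure Xoo]_y (phi y)%:E)%E].

Definition pmG_cvg (X : nat -> pmmSpace R) (Xoo : pmmSpace R) : Prop :=
  exists (Y : polishMetricType R) (iota : forall i, X i -> Y)
         (iotaoo : Xoo -> Y),
    [/\ forall i, isometric_embedding (iota i),
        isometric_embedding iotaoo,
        mdist (iota i (pmm_base (X i))) (iotaoo (pmm_base Xoo)) @[i --> \oo]
          --> (0 : R) &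
        weak_cvg_bbs
          (fun i => pushforward (pmm_measure (X i))
                                (iota i : borel (X i) -> borel Y))
          (pushforward (pmm_measure Xoo) (iotaoo : borel Xoo -> borel Y))].

End Definitions.

(* Main.v *)
From HB Require Import structures.
Require Import Defs.
From mathcomp Require Import all_boot all_order all_algebra.
From mathcomp Require Import zify ring lra.
From mathcomp Require Import all_classical all_reals all_analysis.
From mathcomp Require Import measurable_realfun.

(** Both implications rest on one estimate: if two maps f_i, g_i from X_i to Y
    are e_i-close off a set of measure at most e_i, with e_i -> 0, then the
    images of the measures under f_i and g_i integrate every Lipschitz function
    with bounded support to the same limit; and weak convergence in duality
    with C_bbs can be tested on nonnegative Lipschitz functions.

    From weak approximations, the X_i are glued to X_oo by
      d(x, y) = inf_a d(x, a) + d(psi_i a, y) + e_i,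
    with a ranging over the good set, and to each other through X_oo. Since
    distinct pieces X_i, X_j stay e_i + e_j apart, the disjoint union is already
    complete and no completion is needed. Here f_i is the inclusion and g_i is
    psi_i.

    Conversely, in a common space Y, psi_i sends x to the first point of a dense
    sequence of X_oo at distance less than e / 4 of x. The mass of X_i far from
    X_oo vanishes by testing against the truncated distance to X_oo, and every
    ball of positive measure in X_oo eventually meets X_i, so finitely many
    balls carry the mass of X_oo up to e. A diagonal choice of (r, e)
    concludes. *)

Set Implicit Arguments.
Unset Strict Implicit.
Unset Printing Implicit Defensive.

Import Order.TTheory GRing.Theory Num.Theory.
Import numFieldNormedType.Exports.

Local Open Scope classical_set_scope.
Local Open Scope ring_scope.

(** * Gluing along a hub *)

Section Infimum.
Context {R : realType} {T : Type}.
Implicit Types (A : set T) (f : T -> R).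

Lemma inf_image_le A f x : (forall x, 0 <= f x) -> A x -> inf (f @` A) <= f x.
Proof.
by move=> f0 Ax; apply: ge_inf; [exists 0 => _ [? _ <-]|exists x].
Qed.

Lemma inf_image_ge A f c : A !=set0 -> (forall x, A x -> c <= f x) ->
  c <= inf (f @` A).
Proof.
by move=> [a Aa] fc; apply: lb_le_inf; [exists (f a), a|move=> _ [x Ax <-]; exact: fc].
Qed.

Lemma inf_image_lt A f c : A !=set0 -> (forall x, 0 <= f x) ->
  inf (f @` A) < c -> exists2 x, A x & f x < c.
Proof.
move=> [a Aa] f0 /inf_lt[|_ [x Ax <-] fx]; last by exists x.
by exists (f a), a.
Qed.

End Infimum.
Arguments inf_image_le {R T A f} x.

(** Some ball of radius e/4 belongs to [F] and has a point within e/4 of [x], so all of it stays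
    within 3e/4 of [x]. *)
Lemma cauchy_cluster_cvg {R : realType} (T : metricType R) (F : set_system T)
    (x : T) : ProperFilter F -> cauchy F ->
  (forall e A, 0 < e -> F A -> exists2 t, A t & mdist x t < e) -> F --> x.
Proof.
move=> FF /(@cauchyP R T) cF xF.
apply/metricType_numDomainType.fcvgrPdist_lt => e e0.
have e4 : 0 < e / 4 by rewrite divr_gt0.
have [y Fy] := cF _ e4.
have [t yt xt] := xF _ _ e4 Fy.
near=> s.
have /= : ball y (e / 4) s by near: s.
move: yt; rewrite !ballEmdist/= => yt ys.
have := metric_triangle x t s; have := metric_triangle t y s.
rewrite (metric_sym t y); lra.
Unshelve. all: by end_near. Qed.

(** Gluing data: the last four fields are the triangle inequalities that make [link] a distance
    between a leg and the hub, and the gap keeps this distance positive. *)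
Record star (R : realType) := Star {
  hub : polishMetricType R ;
  leg : nat -> polishMetricType R ;
  link : forall i, leg i -> hub -> R ;
  gap : nat -> R ;
  gap_gt0 : forall i, 0 < gap i ;
  link_gap : forall i x y, gap i <= @link i x y ;
  link_hub : forall i x y y', @link i x y <= @link i x y' + mdist y y' ;
  link_leg : forall i x x' y, @link i x y <= @link i x' y + mdist x x' ;
  leg_le_link : forall i x x' y, mdist x x' <= @link i x y + @link i x' y ;
  hub_le_link : forall i x y y', mdist y y' <= @link i x y + @link i x y' }.

Section Glue.
Context {R : realType} (S : star R).

Let E (o : option nat) : polishMetricType R :=
  if o is Some i then leg S i else hub S.

Definition glue : Type := {o : option nat & E o}.

Definition to_hub (u : glue) : hub S -> R :=
  match u with
  | existT None x => mdist (x : hub S)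
  | existT (Some i) x => @link R S i x
  end.

Definition of_hub (x : hub S) : glue := existT E None x.
Definition of_leg i (x : leg S i) : glue := existT E (Some i) x.

HB.instance Definition _ := gen_eqMixin glue.
HB.instance Definition _ := gen_choiceMixin glue.
HB.instance Definition _ := isPointed.Build glue (of_hub point).

(** Different pieces are joined by the shortest route through one hub point. [tagged_as] casts [v]
    into the fibre of [u], the tags being equal there. *)
Definition glue_dist (u v : glue) : R :=
  if tag u == tag v then mdist (tagged u) (tagged_as u v)
  else inf (range (fun y => to_hub u y + to_hub v y)).

Lemma to_hub_ge0 u y : 0 <= to_hub u y.
Proof.
case: u => -[i|] x /=; last exact: mdist_ge0.
exact: le_trans (ltW (gap_gt0 S i)) (link_gap _ _).
Qed.

Lemma to_hub_lip u y y' : to_hub u y <= to_hub u y' + mdist y y'.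
Proof.
case: u => -[i|] x /=; first exact: link_hub.
by rewrite (metric_sym y y'); exact: metric_triangle.
Qed.

Lemma hub_le_to_hub u y y' : mdist y y' <= to_hub u y + to_hub u y'.
Proof.
case: u => -[i|] x /=; first exact: hub_le_link.
by rewrite (metric_sym x y); exact: metric_triangle.
Qed.

Lemma to_hub_same o (x x' : E o) y :
  to_hub (existT E o x) y <= to_hub (existT E o x') y + mdist x x'.
Proof.
case: o x x' => [i|] x x' /=; first exact: link_leg.
by rewrite addrC; exact: metric_triangle.
Qed.

Lemma same_le_to_hub o (x x' : E o) y :
  mdist x x' <= to_hub (existT E o x) y + to_hub (existT E o x') y.
Proof.
case: o x x' => [i|] x x' /=; first exact: leg_le_link.
by rewrite (metric_sym x' y); exact: metric_triangle.
Qed.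

Lemma glue_dist_same o (x x' : E o) :
  glue_dist (existT E o x) (existT E o x') = mdist x x'.
Proof. by rewrite /glue_dist /= eqxx tagged_asE. Qed.

Lemma glue_dist_diff u v : tag u != tag v ->
  glue_dist u v = inf (range (fun y => to_hub u y + to_hub v y)).
Proof. by rewrite /glue_dist => /negPf ->. Qed.

Let sum_ge0 u v y : 0 <= to_hub u y + to_hub v y.
Proof. by rewrite addr_ge0 ?to_hub_ge0. Qed.

Let hub0 : [set: hub S] !=set0. Proof. by exists point. Qed.

(** Points of one piece are covered by [same_le_to_hub], so a detour through the hub is always an
    upper bound, whatever the pieces. *)
Lemma glue_dist_le u v y : glue_dist u v <= to_hub u y + to_hub v y.
Proof.
case: u v => [ o x] [ o' x']; have [oo|oo] := eqVneq o o'.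
  by subst o'; rewrite glue_dist_same; exact: same_le_to_hub.
rewrite glue_dist_diff//; exact: (inf_image_le y).
Qed.

Lemma glue_dist_lt u v e : tag u != tag v -> glue_dist u v < e ->
  exists y, to_hub u y + to_hub v y < e.
Proof.
by move=> uv; rewrite glue_dist_diff// => /inf_image_lt[]// y _; exists y.
Qed.

Lemma glue_distxx u : glue_dist u u = 0.
Proof. by case: u => o x; rewrite glue_dist_same mdistxx. Qed.

Lemma glue_dist_sym u v : glue_dist u v = glue_dist v u.
Proof.
case: u v => [ o x] [ o' x']; have [oo|oo] := eqVneq o o'.
  by subst o'; rewrite !glue_dist_same metric_sym.
rewrite !glue_dist_diff//; last by rewrite eq_sym.
by congr inf; apply: eq_imagel => y _; rewrite addrC.
Qed.

(** The best intermediate hub point is [y] itself, since [link] is 1-Lipschitz in the hub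
    variable. *)
Lemma glue_dist_hub u y : glue_dist u (of_hub y) = to_hub u y.
Proof.
case: u => -[i|] x; last by rewrite glue_dist_same.
rewrite glue_dist_diff//; apply/eqP; rewrite eq_le; apply/andP; split.
  have := inf_image_le y (sum_ge0 (existT E (Some i) x) (of_hub y)) I.
  by rewrite /= mdistxx addr0.
apply: inf_image_ge => // y' _ /=.
rewrite (metric_sym y y'); have := link_hub x y y'.
by rewrite (metric_sym y y').
Qed.

(** The slack [e] replaces infima by actual hub points. When consecutive points share a piece, the
    end of the detour slides along that piece. When both steps change piece, the detours through [h]
    and [h'] are merged by bounding [mdist h h'] through [v]. *)
Lemma glue_dist_triangle v u w : glue_dist u w <= glue_dist u v + glue_dist v w.
Proof.
suff H e : 0 < e -> glue_dist u w < glue_dist u v + glue_dist v w + e.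
  by apply/ler_addgt0Pr => e /H/ltW.
move=> e0; case: u v w => [i x] [j y] [k z].
have [ij|ij] := eqVneq i j.
  subst j; have [ik|ik] := eqVneq i k.
    by subst k; rewrite !glue_dist_same; have := metric_triangle x y z; lra.
  rewrite (glue_dist_same x y).
  have [] := @glue_dist_lt (existT E i y) (existT E k z)
    (glue_dist (existT E i y) (existT E k z) + e) => //; first lra.
  move=> h hle; have := glue_dist_le (existT E i x) (existT E k z) h.
  have := to_hub_same x y h; lra.
have [jk|jk] := eqVneq j k.
  subst k; rewrite (glue_dist_same y z).
  have [] := @glue_dist_lt (existT E i x) (existT E j y)
    (glue_dist (existT E i x) (existT E j y) + e) => //; first lra.
  move=> h hle; have := glue_dist_le (existT E i x) (existT E j z) h.
  have := to_hub_same z y h; rewrite (metric_sym z y); lra.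
have [] := @glue_dist_lt (existT E i x) (existT E j y)
    (glue_dist (existT E i x) (existT E j y) + e / 2) => //; first lra.
move=> h hle.
have [] := @glue_dist_lt (existT E j y) (existT E k z)
    (glue_dist (existT E j y) (existT E k z) + e / 2) => //; first lra.
move=> h' hle'.
have := glue_dist_le (existT E i x) (existT E k z) h'.
have := to_hub_lip (existT E i x) h' h.
have := hub_le_to_hub (existT E j y) h h'.
rewrite (metric_sym h' h); lra.
Qed.

Lemma glue_dist_positivity u v : glue_dist u v = 0 -> u = v.
Proof.
case: u v => [ o x] [ o' x']; have [oo|oo] := eqVneq o o'.
  by subst o'; rewrite glue_dist_same => /mdist_positivity ->.
rewrite glue_dist_diff// => d0.
(* Distinct pieces are not both the hub: one of them is a leg, and its gap is a uniform lower
   bound. *)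
suff [c c0 cd] : exists2 c, 0 < c & forall y,
    c <= to_hub (existT E o x) y + to_hub (existT E o' x') y.
  have : c <= 0 by rewrite -d0; apply: inf_image_ge => // y _; exact: cd.
  by rewrite leNgt c0.
clear d0; case: o x oo => [i|] x oo.
  exists (gap S i); first exact: gap_gt0.
  move=> y; rewrite [to_hub (existT _ (Some _) _) y]/=.
  by have := link_gap x y; have := to_hub_ge0 (existT E o' x') y; lra.
case: o' x' oo => [i|] x' // _.
exists (gap S i); first exact: gap_gt0.
move=> y; rewrite [to_hub (existT _ (Some _) _) y]/=.
by have := link_gap x' y; have := to_hub_ge0 (existT E None x) y; lra.
Qed.

HB.instance Definition _ := @isMetric.Build R glue glue_dist glue_distxx
  glue_dist_positivity glue_dist_sym glue_dist_triangle.

Lemma mdist_glue (u v : glue) : mdist u v = glue_dist u v.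
Proof. by []. Qed.

Lemma mdist_to_hub (u : glue) y : mdist u (of_hub y : glue) = to_hub u y.
Proof. by rewrite mdist_glue glue_dist_hub. Qed.

Lemma glue_separable : exists2 D : set glue, countable D & dense D.
Proof.
have sepE o : exists D : set (E o), countable D /\ dense D.
  by have [D] := @separable R (E o); exists D.
have [D DP] : {D : forall o, set (E o) & forall o, countable (D o) /\ dense (D o)}.
  by exists (fun o => sval (cid (sepE o))) => o; exact: svalP (cid (sepE o)).
exists (\bigcup_o (existT E o @` D o)).
  apply: bigcup_countable => // o _.
  by apply: card_le_trans (card_image_le _ _) _; case: (DP o).
move=> O [[ o x] Ox] oO.
have /nbhs_ballP[e /= e0 eO] : nbhs (existT E o x : glue) O.
  by apply: open_nbhs_nbhs; split.
have [y [xy Dy]] : ball x e `&` D o !=set0.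
  have [_] := DP o; move=> /(_ (interior (ball x e))).
  case => [||y [/interior_subset xy Dy]].
  - by exists x; rewrite /interior; exact: nbhsx_ballx.
  - exact: open_interior.
  - by exists y.
exists (existT E o y); split; last by exists o => //; exists y.
apply: eO; rewrite ballEmdist /= mdist_glue glue_dist_same.
by move: xy; rewrite ballEmdist.
Qed.

(** Either all members of [F] meet one fixed piece, whose completeness gives the limit, or every
    piece is missed by some member. Then small members contain points of two pieces, hence come
    close to the hub, and the limit is a hub point. *)
Lemma glue_complete (F : set_system glue) :
  ProperFilter F -> cauchy F -> cvg F.
Proof.
move=> FF cF; have /(@cauchyP R glue) cF' := cF.
have [[ o Fo]|noF] := pselect (exists o, forall A, F A -> exists x, A (existT E o x)).
  (* The trace of [F] on the piece [o]. *)
  pose G := filter_from F (fun A => existT E o @^-1` A).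
  have GF : ProperFilter G.
    apply: filter_from_proper; last by move=> A /Fo[x Ax]; exists x.
    apply: filter_from_filter; first by exists setT; exact: filterT.
    by move=> A B FA FB; exists (A `&` B) => //; exact: filterI.
  have /cauchy_cvg/cvg_ex[/= x Gx] : cauchy (G : set_system (E o)).
    apply: cauchy_exP => e e0.
    have [u Fu] := cF' (e / 2) (divr_gt0 e0 (ltr0Sn _ 1)).
    have [x ux] := Fo _ Fu.
    exists x; exists (ball u (e / 2)) => // y /= uy.
    move: ux uy; rewrite !ballEmdist /= => ux uy.
    have := metric_triangle (existT E o x : glue) u (existT E o y).
    rewrite [X in X <= _]mdist_glue glue_dist_same metric_sym; lra.
  apply/cvg_ex; exists (existT E o x : glue).
  apply: cauchy_cluster_cvg => // e A e0 FA.
  have [B FB BA] := Gx _ (nbhsx_ballx x e e0).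
  have [y [Ay By]] := Fo _ (filterI FA FB).
  exists (existT E o y) => //; rewrite mdist_glue glue_dist_same.
  by move: (BA y By); rewrite ballEmdist.
have hubF e : 0 < e -> exists y, F (ball (of_hub y : glue) e).
  move=> e0; have [u Fu] := cF' (e / 4) (divr_gt0 e0 (ltr0Sn _ 3)).
  have /filter_ex[[ o x] uox] := Fu.
  (* A member avoiding the piece of [x] provides a point [x'] of another piece, whose distance to
     [x] is measured through the hub. *)
  have [A [FA nA]] : exists A, F A /\ forall x : E o, ~ A (existT E o x).
    apply: contrapT => H; apply: noF; exists o => A FA.
    apply: contrapT => nA; apply: H; exists A; split => // y Ay.
    by apply: nA; exists y.
  have [[ o' x'] [uox' Ax']] := filter_ex (filterI Fu FA).
  have oo' : tag (existT E o x) != tag (existT E o' x').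
    apply/eqP => /= oo; subst o'; exact: nA Ax'.
  have [|y hy] := @glue_dist_lt _ _ (e / 2) oo'.
    move: uox uox'; rewrite !ballEmdist /= => ux uy.
    have := metric_triangle (existT E o x : glue) u (existT E o' x').
    rewrite [X in X <= _]mdist_glue (metric_sym _ u); lra.
  exists y; apply: filterS Fu => v.
  move: uox; rewrite !ballEmdist /= => ux uv.
  have := metric_triangle (of_hub y : glue) (existT E o x) v.
  have := metric_triangle (existT E o x : glue) u v.
  rewrite (metric_sym (of_hub y : glue) (existT E o x)) mdist_to_hub.
  have := to_hub_ge0 (existT E o' x') y.
  rewrite (metric_sym _ u); lra.
(* The approximate positions of [F] in the hub: [G] is generated by the sets of centres whose
   [e]-ball belongs to [F]. *)
pose G := filter_from [set e : R | 0 < e]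
  (fun e => [set y | F (ball (of_hub y : glue) e)]).
have GF : ProperFilter G.
  apply: filter_from_proper; last by move=> e /hubF.
  apply: filter_from_filter; first by exists 1 => /=.
  move=> e e' /= e0 e0'; exists (Num.min e e') => /=.
    by rewrite lt_min e0.
  move=> y /= Fy; split; apply: filterS Fy => v; rewrite !ballEmdist /= lt_min.
    by case/andP.
  by case/andP.
have /cauchy_cvg/cvg_ex[/= z Gz] : cauchy (G : set_system (hub S)).
  apply: cauchy_exP => e e0; have e2 : 0 < e / 2 by rewrite divr_gt0.
  have [y Fy] := hubF _ e2; exists y; exists (e / 2) => // y' /= Fy'.
  have [v [yv y'v]] := filter_ex (filterI Fy Fy').
  move: yv y'v; rewrite !ballEmdist /= => yv y'v.
  have := metric_triangle (of_hub y : glue) v (of_hub y').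
  rewrite (metric_sym v) [X in X <= _]mdist_glue glue_dist_same; lra.
apply/cvg_ex; exists (of_hub z : glue).
apply/metricType_numDomainType.fcvgrPdist_lt => e e0.
have e2 : 0 < e / 2 by rewrite divr_gt0.
have [d /= d0 dz] := Gz _ (nbhsx_ballx z _ e2).
have [|y Fy] := hubF (Num.min d (e / 2)); first by rewrite lt_min d0.
have /dz : F (ball (of_hub y : glue) d).
  by apply: filterS Fy => v; rewrite !ballEmdist /= lt_min => /andP[].
rewrite ballEmdist /= => zy.
apply: filterS Fy => v; rewrite ballEmdist /= lt_min => /andP[_ yv].
have := metric_triangle (of_hub z : glue) (of_hub y) v.
rewrite [X in _ <= X + _]mdist_glue glue_dist_same; lra.
Qed.

HB.instance Definition _ := Uniform_isComplete.Build glue glue_complete.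

HB.instance Definition _ := Topological_isSeparable.Build glue glue_separable.

Definition glue_polish : polishMetricType R := glue.

Lemma isometric_of_hub : isometric_embedding (of_hub : hub S -> glue_polish).
Proof. by move=> x y; rewrite mdist_glue glue_dist_same. Qed.

Lemma isometric_of_leg i : isometric_embedding (@of_leg i : leg S i -> glue_polish).
Proof. by move=> x y; rewrite mdist_glue glue_dist_same. Qed.

Lemma mdist_leg_hub i (x : leg S i) y :
  mdist (of_leg x : glue_polish) (of_hub y) = link x y.
Proof. exact: mdist_to_hub. Qed.

End Glue.

(** * Lipschitz test functions *)

Section Lipschitz.
Context {R : realType}.

Definition lipschitz_with (T : metricType R) (k : R) (f : T -> R) :=
  forall x y, f x <= f y + k * mdist x y.

Lemma lipschitz_with_dist (T : metricType R) k (f : T -> R) x y :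
  lipschitz_with k f -> `|f x - f y| <= k * mdist x y.
Proof.
move=> fk; rewrite ler_norml; have := fk x y; have := fk y x.
rewrite (metric_sym y x); lra.
Qed.

Lemma lipschitz_continuous (T : metricType R) k (f : T -> R) :
  lipschitz_with k f -> continuous f.
Proof.
move=> fk x; apply/cvgrPdist_lt => e e0.
(* [k] may be zero or negative, hence the division by [Num.max k 1]. *)
have k1 : 0 < Num.max k 1 by rewrite lt_max ltr01 orbT.
near=> y.
apply: (le_lt_trans (lipschitz_with_dist x y fk)).
have : ball x (e / Num.max k 1) y.
  by near: y; apply: nbhsx_ballx; rewrite divr_gt0.
rewrite ballEmdist /= ltr_pdivlMr// mulrC; apply: le_lt_trans.
by rewrite ler_wpM2r ?mdist_ge0// le_max lexx.
Unshelve. all: by end_near. Qed.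

Lemma lipschitz_min (T : metricType R) k (f g : T -> R) :
  lipschitz_with k f -> lipschitz_with k g ->
  lipschitz_with k (fun x => Num.min (f x) (g x)).
Proof.
by move=> fk gk x y; rewrite addr_minl le_min !ge_min fk gk orbT.
Qed.

Lemma lipschitz_with_le (T : metricType R) k k' (f : T -> R) :
  k <= k' -> lipschitz_with k f -> lipschitz_with k' f.
Proof.
move=> kk fk x y; apply: le_trans (fk x y) _.
by rewrite lerD2l ler_wpM2r ?mdist_ge0.
Qed.

(** The ramp that falls from 1 at distance [r] to 0 at distance [r + 1]. *)
Definition cutoff (T : metricType R) (o : T) (r : R) (x : T) : R :=
  Num.min 1 (Num.max 0 (r + 1 - mdist o x)).

Lemma lipschitz_cutoff (T : metricType R) (o : T) r :
  lipschitz_with 1 (cutoff o r).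
Proof.
apply: lipschitz_min => [x y|x y]; first by rewrite mul1r lerDl mdist_ge0.
rewrite mul1r ge_max addr_ge0 ?mdist_ge0 ?le_max ?lexx//=.
have := metric_triangle o x y => oxy.
apply: (@le_trans _ _ (r + 1 - mdist o y + mdist x y)); first lra.
by rewrite lerD2r le_max lexx orbT.
Qed.

Lemma cutoff_ge0 (T : metricType R) (o x : T) r : 0 <= cutoff o r x.
Proof. by rewrite /cutoff le_min ler01 le_max lexx. Qed.

Lemma cutoff_le1 (T : metricType R) (o x : T) r : cutoff o r x <= 1.
Proof. by rewrite /cutoff ge_min lexx. Qed.

Lemma cutoff1 (T : metricType R) (o x : T) r : mdist o x <= r -> cutoff o r x = 1.
Proof. by move=> h; rewrite /cutoff; apply/min_idPl; rewrite le_max; apply/orP; right; lra. Qed.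

Lemma cutoff_neq0 (T : metricType R) (o x : T) r :
  cutoff o r x != 0 -> mdist o x < r + 1.
Proof.
move=> h; rewrite ltNge; apply: contra h => h.
by rewrite /cutoff (max_idPl _) ?subr_le0//; apply/eqP/min_idPr.
Qed.

End Lipschitz.

(** * Lipschitz envelopes along a map *)

Section Envelope.
Context {R : realType} {Z Y : polishMetricType R} (iota : Z -> Y).
Context (phi : Z -> R) (phi0 : forall z, 0 <= phi z).

(* The largest [k]-Lipschitz function on Y below [phi] along [iota]. *)
Definition envelope (k : R) (y : Y) : R :=
  inf (range (fun z => phi z + k * mdist y (iota z))).

Let ge0 k y : 0 <= k -> forall z, 0 <= phi z + k * mdist y (iota z).
Proof. by move=> k0 z; rewrite addr_ge0// mulr_ge0// mdist_ge0. Qed.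

Let Z0 : [set: Z] !=set0. Proof. by exists point. Qed.

Lemma envelope_ge0 k y : 0 <= k -> 0 <= envelope k y.
Proof. by move=> k0; apply: inf_image_ge => // z _; exact: ge0. Qed.

Lemma envelope_le k z : 0 <= k -> envelope k (iota z) <= phi z.
Proof.
move=> k0; have := inf_image_le z (ge0 (iota z) k0) I.
by rewrite mdistxx mulr0 addr0.
Qed.

Lemma lipschitz_envelope k : 0 <= k -> lipschitz_with k (envelope k).
Proof.
move=> k0 x y; rewrite -lerBlDr; apply: inf_image_ge => // z _.
have := inf_image_le z (ge0 x k0) I.
rewrite -/(envelope k x) lerBlDr => /le_trans; apply.
by rewrite -addrA lerD2l -mulrDr ler_wpM2l// addrC metric_triangle.
Qed.

Lemma le_envelope k k' y : 0 <= k -> k <= k' -> envelope k y <= envelope k' y.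
Proof.
move=> k0 kk; apply: inf_image_ge => // z _.
apply: le_trans (inf_image_le z (ge0 y k0) I) _.
by rewrite lerD2l ler_wpM2r ?mdist_ge0.
Qed.

Hypothesis iotaE : isometric_embedding iota.

(** For Lipschitz [phi] the envelope is the McShane extension. *)
Lemma envelope_lipschitz k z : 0 <= k -> lipschitz_with k phi ->
  envelope k (iota z) = phi z.
Proof.
move=> k0 kphi; apply/eqP; rewrite eq_le envelope_le//=.
by apply: inf_image_ge => // z' _; rewrite iotaE.
Qed.

(** Points close to [z] have almost the same value by continuity; a point at distance at least [d]
    pays [n * d], which exceeds [phi z] once [n] is at least [phi z / d]. *)
Lemma envelope_cvg z : {for z, continuous phi} ->
  envelope n%:R (iota z) @[n --> \oo] --> phi z.
Proof.
move=> cphi; apply/cvgrPdist_le => e e0.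
have /nbhs_ballP[d /= d0 dphi] : \forall z' \near z, `|phi z - phi z'| < e.
  by move/cvgrPdist_lt : cphi; apply.
near=> n.
have n0 : 0 <= n%:R :> R by [].
rewrite ger0_norm ?subr_ge0 ?envelope_le// lerBlDr addrC -lerBlDr.
apply: inf_image_ge => // z' _; rewrite iotaE.
have [zd|zd] := ltP (mdist z z') d.
  have := dphi z'; rewrite ballEmdist /= => /(_ zd); rewrite ltr_norml.
  have : 0 <= n%:R * mdist z z' by rewrite mulr_ge0 ?mdist_ge0.
  lra.
have : phi z / d * d <= n%:R * mdist z z'.
  apply: ler_pM => //; [by rewrite divr_ge0// ltW|exact: ltW|].
  by near: n; exact: nbhs_infty_ger.
rewrite divfK ?gt_eqF//; have := phi0 z'; lra.
Unshelve. all: by end_near. Qed.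

End Envelope.

Lemma isometric_continuous {R : realType} (Z Y : polishMetricType R)
    (iota : Z -> Y) : isometric_embedding iota -> continuous iota.
Proof.
move=> iotaE z; apply/metricType_numDomainType.cvgrPdist_lt => e e0.
by near=> z'; rewrite iotaE; near: z';
  apply: (metricType_numDomainType.cvgr_dist_lt (f := id)).
Unshelve. all: by end_near. Qed.

(** * Test functions with bounded support *)

Section CbbsFacts.
Context {R : realType}.

(** The support is tested pointwise: passing to the closure costs less than 1 in the radius. *)
Lemma CbbsI (Y : polishMetricType R) (phi : Y -> R) (o : Y) (r M : R) : continuous phi ->
  (forall x, `|phi x| <= M) -> (forall x, phi x != 0 -> mdist o x < r) ->
  Cbbs phi.
Proof.
move=> cphi Mphi rphi; split => //.
  exists M; split; first exact: num_real.
  by move=> N /ltW MN x _ /=; exact: le_trans (Mphi x) MN.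
exists o, (r + 1) => x /(_ _ (nbhsx_ballx x 1 ltr01)) [y [/= /rphi oy]].
rewrite !ballEmdist /= => xy; have := metric_triangle o y x.
rewrite (metric_sym y x); lra.
Qed.

Lemma CbbsE (Y : polishMetricType R) (phi : Y -> R) (o : Y) : Cbbs phi ->
  exists r M, [/\ 0 < r, 0 < M, continuous phi, forall x, `|phi x| <= M &
                 forall x, phi x != 0 -> mdist o x < r].
Proof.
move=> [cphi [M [_ Mphi]] [x0 [r0 sub]]].
exists (mdist o x0 + `|r0| + 1), (`|M| + 1); split => //.
- by have := mdist_ge0 o x0; have := normr_ge0 r0; lra.
- by move=> x; apply: (Mphi (`|M| + 1)) => //; rewrite (le_lt_trans (ler_norm M))// ltrDl.
- move=> x /(@subset_closure _ [set x | phi x != 0] x)/sub.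
  rewrite ballEmdist /= => x0r; have := metric_triangle o x0 x.
  have := ler_norm r0; lra.
Qed.

Lemma Cbbs_cutoff (Y : polishMetricType R) (o : Y) r : Cbbs (cutoff o r).
Proof.
apply: (@CbbsI _ _ o (r + 1) 1).
- exact: lipschitz_continuous (@lipschitz_cutoff _ _ o r).
- by move=> x; rewrite ger0_norm ?cutoff_ge0// cutoff_le1.
- move=> x; exact: cutoff_neq0.
Qed.

Lemma Cbbs_comp (Z Y : polishMetricType R) (iota : Z -> Y) (phi : Y -> R) :
  isometric_embedding iota -> Cbbs phi -> Cbbs (phi \o iota).
Proof.
move=> iotaE /(CbbsE (iota point))[r [M [r0 M0 cphi Mphi rphi]]].
apply: (@CbbsI _ _ point r M) => //= [z|z /rphi]; last by rewrite iotaE.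
by apply: continuous_comp; [exact: isometric_continuous|exact: cphi].
Qed.

End CbbsFacts.

(** * Borel measurability and integrability *)

Section Borel.
Context {R : realType}.

Lemma borel_open (Y : polishMetricType R) (U : set Y) :
  open U -> measurable (U : set (borel Y)).
Proof. exact: sub_sigma_algebra. Qed.

Lemma metric_open_ball (Z : polishMetricType R) (z : Z) r : open (ball z r).
Proof.
rewrite ballEmdist.
apply: (open_comp (f := mdist z) (D := [set x | x < r])); last exact: open_lt.
move=> y _; apply: (@lipschitz_continuous _ _ 1) => x t.
by rewrite mul1r (metric_sym x t) metric_triangle.
Qed.

Lemma borel_ball (Y : polishMetricType R) (o : Y) r :
  measurable (ball o r : set (borel Y)).
Proof. by apply: borel_open; exact: metric_open_ball. Qed.

Lemma continuous_borel (Y Z : polishMetricType R) (f : Y -> Z) :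
  continuous f -> measurable_fun setT (f : borel Y -> borel Z).
Proof.
move=> cf; apply: (@measurability _ _ (borel Y) (borel Z) setT f (@open Z)) => //.
by move=> _ [B oB <-]; rewrite setTI; apply: borel_open; apply: open_comp.
Qed.

Lemma continuous_borel_real (Y : polishMetricType R) (f : Y -> R) :
  continuous f -> measurable_fun setT (f : borel Y -> R).
Proof.
move=> cf; apply: (measurability _ (RGenOpens.measurableE R)).
move=> _ [_ [a [b ->] <-]]; rewrite setTI; apply: borel_open.
by apply: open_comp => //; exact: interval_open.
Qed.

End Borel.

(** * Integrals against image measures that are finite on balls *)

Section BallFinite.
Context {R : realType} {d : measure_display} {X : measurableType d}.
Context (mu : {measure set X -> \bar R}) {Y : polishMetricType R}.
Implicit Types (D A : set X) (f g : X -> Y) (phi psi chi : Y -> R).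

(** The image under [f] of the restriction of [mu] to [D] is finite on balls. Carrying [D] along
    treats isometric embeddings of whole spaces and maps meaningful only on a ball alike. *)
Definition ball_finite D f : Prop :=
  [/\ measurable D, measurable_fun D (f : X -> borel Y) &
      forall o r, (mu (D `&` f @^-1` ball o r) < +oo)%E].

Lemma ball_finiteS D A f : measurable A -> A `<=` D ->
  ball_finite D f -> ball_finite A f.
Proof.
move=> mA AD [mD mf fin]; split => // [|o r].
  exact: measurable_funS mf.
apply: le_lt_trans (fin o r); apply: le_measure; rewrite ?inE.
- by apply: (measurable_funS mD AD mf) => //; exact: borel_ball.
- by apply: mf => //; exact: borel_ball.
- exact: setSI.
Qed.

Lemma ball_finite_finite D f : measurable D -> (mu D < +oo)%E ->
  measurable_fun D (f : X -> borel Y) -> ball_finite D f.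
Proof.
move=> mD Doo mf; split => // o r; apply: le_lt_trans Doo.
by apply: le_measure; rewrite ?inE//; apply: mf => //; exact: borel_ball.
Qed.

Lemma ball_finite_setD_le D A f o r : measurable A -> ball_finite D f ->
  (mu ((D `\` A) `&` f @^-1` ball o r) <= mu (D `\` A))%E.
Proof.
move=> mA [mD mf _]; have mDA := measurableD mD mA.
apply: le_measure; rewrite ?inE//.
by apply: (measurable_funS mD _ mf) => //; exact: borel_ball.
Qed.

Section OneMap.
Context {D : set X} {f : X -> Y} (Df : ball_finite D f).

Let mD : measurable D. Proof. by case: Df. Qed.

Lemma ball_finite_measurable phi : Cbbs phi -> measurable_fun D (phi \o f).
Proof.
case: Df => _ mf _ [cphi _ _].
by apply: (@measurableT_comp _ _ _ _ (borel Y)) mf; exact: continuous_borel_real.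
Qed.

(** On [D] the integrand vanishes outside the preimage of a ball, where it is bounded and the mass
    is finite. *)
Lemma ball_finite_integrable phi : Cbbs phi ->
  mu.-integrable D (EFin \o (phi \o f)).
Proof.
move=> Cphi; have [r [M [r0 M0 cphi Mphi rphi]]] := CbbsE point Cphi.
have mphi := ball_finite_measurable Cphi.
pose D' := D `&` f @^-1` ball point r.
have mD' : measurable D' by case: Df => _ mf _; apply: mf => //; exact: borel_ball.
apply/integrable_mkcond => //.
have -> : (EFin \o (phi \o f)) \_ D = (EFin \o (phi \o f)) \_ D'.
  apply/funext => x; rewrite /patch.
  have [Dx|Dx] := pselect (D x); last by rewrite !memNset// => -[].
  rewrite (mem_set Dx); case: ifPn => // /negP; rewrite inE => nD'.
  congr EFin; apply: contrapT => /eqP/rphi h; apply: nD'.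
  by split => //; rewrite /= ballEmdist.
apply/(integrable_mkcond _ mD'); apply: measurable_bounded_integrable => //.
- by case: Df => _ _; exact.
- by apply: (measurable_funS mD _ mphi); exact: subIsetl.
- exists M; split; first exact: num_real.
  by move=> N /ltW MN x _ /=; exact: le_trans (Mphi _) MN.
Qed.

Lemma ball_finite_integralE phi : Cbbs phi ->
  (\int[mu]_(x in D) (phi (f x))%:E)%E = (\int[mu]_(x in D) phi (f x))%R%:E.
Proof.
by move=> Cphi; rewrite fineK// integrable_fin_num//; exact: ball_finite_integrable.
Qed.

Lemma ball_finite_le phi psi : Cbbs phi -> Cbbs psi ->
  (forall x, D x -> phi (f x) <= psi (f x)) ->
  (\int[mu]_(x in D) phi (f x) <= \int[mu]_(x in D) psi (f x))%R.
Proof.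
by move=> Cphi Cpsi le; apply: le_Rintegral => //; exact: ball_finite_integrable.
Qed.

Lemma ball_finite_ge0 phi : (forall y, 0 <= phi y) ->
  0 <= (\int[mu]_(x in D) phi (f x))%R.
Proof. by move=> phi0; apply: Rintegral_ge0. Qed.

Lemma ball_finite_subset A phi : measurable A -> A `<=` D -> Cbbs phi ->
  (forall y, 0 <= phi y) ->
  (\int[mu]_(x in A) phi (f x) <= \int[mu]_(x in D) phi (f x))%R.
Proof.
move=> mA AD Cphi phi0.
have CA : mu.-integrable A (EFin \o (phi \o f)).
  by apply: integrableS (ball_finite_integrable Cphi).
apply: fine_le; rewrite ?integrable_fin_num//; first exact: ball_finite_integrable.
apply: ge0_subset_integral => //; last by move=> x _; rewrite lee_fin.
by apply/measurable_EFinP; exact: ball_finite_measurable.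
Qed.

(** Off [A] the integrand is at most [M] and lives on the preimage of [ball o r], which has mass at
    most [e] there. *)
Lemma ball_finite_split A phi M e o r : measurable A -> A `<=` D -> Cbbs phi ->
  (forall y, 0 <= phi y <= M) -> (forall y, phi y != 0 -> mdist o y < r) ->
  (mu ((D `\` A) `&` f @^-1` ball o r) <= e%:E)%E ->
  (\int[mu]_(x in D) phi (f x) <= \int[mu]_(x in A) phi (f x) + M * e)%R.
Proof.
move=> mA AD Cphi Mphi rphi mue.
have M0 : 0 <= M by have /andP[] := Mphi point; exact: le_trans.
have mphi := ball_finite_measurable Cphi.
pose B := (D `\` A) `&` f @^-1` ball o r.
have mDA : measurable (D `\` A) by exact: measurableD.
have mB : measurable B.
  case: Df => _ mf _.
  by apply: (measurable_funS mD (@subDsetl _ D A) mf) => //; exact: borel_ball.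
have iphi := ball_finite_integrable Cphi.
have -> : (\int[mu]_(x in D) phi (f x) =
   \int[mu]_(x in A) phi (f x) + \int[mu]_(x in D `\` A) phi (f x))%R.
  rewrite -[in LHS](setDUK AD) Rintegral_setU//; last by rewrite disj_set2E setDIK.
  by rewrite setDUK.
rewrite lerD2l.
have -> : (\int[mu]_(x in D `\` A) phi (f x) = \int[mu]_(x in B) phi (f x))%R.
  rewrite Rintegral_mkcond [RHS]Rintegral_mkcond; congr (Rintegral _ _ _).
  apply/funext => x; rewrite /patch.
  have [DAx|DAx] := pselect ((D `\` A) x); last by rewrite !memNset// => -[].
  rewrite (mem_set DAx); case: ifPn => // /negP; rewrite inE => nB.
  apply: contrapT => /eqP/rphi h; apply: nB.
  by split => //; rewrite /= ballEmdist.
have Boo : (mu B < +oo)%E by apply: le_lt_trans mue _; rewrite ltry.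
apply: (@le_trans _ _ (\int[mu]_(x in B) M)%R).
  apply: le_Rintegral => //; last by move=> x _; have /andP[] := Mphi (f x).
    by apply: integrableS iphi => //; move=> x [[]].
  apply: measurable_bounded_integrable => //.
  by exists M; split; [exact: num_real|move=> N /ltW MN x _ /=; rewrite ger0_norm].
rewrite Rintegral_cst// ler_wpM2l//.
rewrite -lee_fin fineK// ge0_fin_numE//.
Qed.

End OneMap.

End BallFinite.

(** * Testing weak convergence on Lipschitz functions *)

Section LimitMeasure.
Context {R : realType} {Y : polishMetricType R}.
Context {nu : {measure set (borel Y) -> \bar R}}.
Hypothesis nu_fin : forall o r, (nu (ball o r) < +oo)%E.

Lemma ball_finite_id : ball_finite nu (setT : set (borel Y)) id.
Proof. by split => // o r; rewrite setTI; exact: nu_fin. Qed.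

(** The envelopes of slope [n] increase to [phi], so monotone convergence applies. *)
Lemma lipschitz_below (phi : Y -> R) e : 0 < e -> Cbbs phi ->
  (forall y, 0 <= phi y) ->
  exists k psi, [/\ 0 <= k, lipschitz_with k psi, Cbbs psi,
    forall y, 0 <= psi y <= phi y &
    (\int[nu]_y phi y - e <= \int[nu]_y psi y)%R].
Proof.
move=> e0 Cphi phi0.
have [r [M [r0 M0 cphi Mphi rphi]]] := CbbsE point Cphi.
have idE : isometric_embedding (@idfun Y) by [].
pose psi n := envelope (@idfun Y) phi n%:R.
have n0 n : 0 <= n%:R :> R by [].
have psi01 n y : 0 <= psi n y <= phi y.
  by rewrite /psi envelope_ge0//=; apply: (envelope_le (@idfun Y)).
have Cpsi n : Cbbs (psi n).
  apply: (CbbsI (o := point) (r := r) (M := M)).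
  - exact: lipschitz_continuous (lipschitz_envelope (@idfun Y) phi0 (n0 n)).
  - move=> y; have /andP[psi0 psi1] := psi01 n y.
    rewrite ger0_norm//; apply: le_trans psi1 _.
    exact: le_trans (ler_norm _) (Mphi y).
  - move=> y psi_neq; apply: rphi; apply: contra psi_neq => /eqP phi_eq.
    by have := psi01 n y; rewrite phi_eq -eq_le eq_sym.
have : (\int[nu]_y (psi n y)%:E)%E @[n --> \oo] --> (\int[nu]_y (phi y)%:E)%E.
  have -> : (\int[nu]_y (phi y)%:E)%E =
      (\int[nu]_y limn (fun n => (psi n y)%:E))%E.
    apply: eq_integral => y _; apply/esym/cvg_lim => //.
    apply: cvg_EFin; first by near=> n.
    exact: (envelope_cvg phi0 idE (cphi y)).
  apply: cvg_monotone_convergence => //.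
  - move=> n; apply/measurable_EFinP.
    by have [cpsi _ _] := Cpsi n; exact: continuous_borel_real.
  - by move=> n y _; rewrite lee_fin; case/andP: (psi01 n y).
  - by move=> y _ n m nm; rewrite lee_fin; apply: le_envelope => //; rewrite ler_nat.
rewrite (ball_finite_integralE ball_finite_id)//.
move=> /fine_cvgP[_] /cvgrPdist_lt /(_ _ e0)[n _ /(_ n (leqnn n))].
rewrite /= ltr_norml => /andP[_ h].
exists n%:R, (psi n); split => //.
- exact: (lipschitz_envelope (@idfun Y)).
- by apply: ltW; rewrite ltrBlDr -ltrBlDl.
Unshelve. all: by end_near. Qed.

End LimitMeasure.

Section Sequences.
Context {R : realType} {X : nat -> pmmSpace R} {Y : polishMetricType R}.
Context {nu : {measure set (borel Y) -> \bar R}}.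
Hypothesis nu_fin : forall o r, (nu (ball o r) < +oo)%E.

Local Notation m i := (pmm_measure (X i)).

(** One form for both modes of convergence: [D] is the whole space for push-forwards and a ball for
    approximations. *)
Definition tested (D : forall i, set (borel (X i))) (f : forall i, X i -> Y)
    (phi : Y -> R) : Prop :=
  (\int[m i]_(x in D i) (phi (f i x))%:E)%E @[i --> \oo]
    --> (\int[nu]_y (phi y)%:E)%E.

Lemma testedE (D : forall i, set (borel (X i))) (f : forall i, X i -> Y) phi :
  (\forall i \near \oo, ball_finite (m i) (D i) (f i)) -> Cbbs phi ->
  tested D f phi <->
  (\int[m i]_(x in D i) phi (f i x))%R @[i --> \oo] --> (\int[nu]_y phi y)%R.
Proof.
move=> Df Cphi; rewrite /tested.
rewrite (ball_finite_integralE (ball_finite_id nu_fin))//.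
split=> [/fine_cvgP[]//|h]; apply/fine_cvgP; split => //.
near=> i; have Di : ball_finite (m i) (D i) (f i) by near: i.
by rewrite (ball_finite_integralE Di).
Unshelve. all: by end_near. Qed.

(* Lipschitz functions below [phi] and below [M chi - phi], for a cutoff [chi],
   bound the integral of [phi] from both sides. *)
Lemma tested_lipschitz (D : forall i, set (borel (X i))) (f : forall i, X i -> Y) :
  (\forall i \near \oo, ball_finite (m i) (D i) (f i)) ->
  (forall k phi, 0 <= k -> lipschitz_with k phi -> Cbbs phi ->
    (forall y, 0 <= phi y) -> tested D f phi) ->
  forall phi, Cbbs phi -> tested D f phi.
Proof.
move=> Df lipD phi Cphi; apply/testedE => //.
(* Lower semicontinuity on nonnegative functions: a Lipschitz function below [psi] loses at most e/2
   of the integral, and its own integrals converge. *)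
have lower psi e : 0 < e -> Cbbs psi -> (forall y, 0 <= psi y) ->
    \forall i \near \oo, (\int[nu]_y psi y - e <=
      \int[m i]_(x in D i) psi (f i x))%R.
  move=> e0 Cpsi psi0; have e2 : 0 < e / 2 by rewrite divr_gt0.
  have [k [g [k0 gk Cg g01 ge]]] := lipschitz_below nu_fin e2 Cpsi psi0.
  have g0 y : 0 <= g y by case/andP: (g01 y).
  have /(testedE Df Cg)/cvgrPdist_lt/(_ _ e2) := lipD _ _ k0 gk Cg g0.
  move=> H; near=> i.
  have Di : ball_finite (m i) (D i) (f i) by near: i.
  have : (\int[m i]_(x in D i) g (f i x) <= \int[m i]_(x in D i) psi (f i x))%R.
    by apply: ball_finite_le => // x _; case/andP: (g01 (f i x)).
  have : `|\int[nu]_y g y - \int[m i]_(x in D i) g (f i x)|%R < e / 2.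
    by near: i.
  rewrite ltr_norml => /andP[]; lra.
have [r [M [r0 M0 cphi Mphi rphi]]] := CbbsE point Cphi.
pose chi := cutoff (point : Y) r.
have Cchi : Cbbs chi by exact: Cbbs_cutoff.
have Mchi y : `|phi y| <= M * chi y.
  have [h|h] := eqVneq (phi y) 0.
    by rewrite h normr0 mulr_ge0 ?cutoff_ge0// ltW.
  by rewrite /chi cutoff1 ?mulr1//; apply: ltW; exact: rphi.
have Ccomb s : Cbbs (fun y => M * chi y + s * phi y).
  have [cchi _ _] := Cchi.
  apply: (CbbsI (o := point) (r := r + 1) (M := M + `|s| * M)).
  - by move=> y; apply: cvgD; apply: cvgM; [exact: cvg_cst|exact: cchi|exact: cvg_cst|exact: cphi].
  - move=> y; apply: le_trans (ler_normD _ _) _; rewrite !normrM.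
    rewrite (gtr0_norm M0) (ger0_norm (cutoff_ge0 _ _ _)).
    by apply: lerD; [rewrite ler_piMr ?cutoff_le1// ltW|rewrite ler_wpM2l].
  - move=> y; apply: contraNT; rewrite -leNgt => h.
    have -> : phi y = 0.
      apply/eqP; apply: contraT => /rphi yr; move: h; rewrite leNgt => /negP[].
      by apply: lt_trans yr _; rewrite ltrDl.
    have -> : chi y = 0.
      apply/eqP; apply: contraT => /cutoff_neq0 yr.
      by move: h; rewrite leNgt yr.
    by rewrite !mulr0 addr0.
have comb0 s y : s = 1 \/ s = -1 -> 0 <= M * chi y + s * phi y.
  by have := Mchi y; rewrite ler_norml => /andP[h1 h2] [] ->; lra.
have combE i s : ball_finite (m i) (D i) (f i) ->
    (\int[m i]_(x in D i) (M * chi (f i x) + s * phi (f i x)) =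
     M * \int[m i]_(x in D i) chi (f i x) + s * \int[m i]_(x in D i) phi (f i x))%R.
  move=> Di; have [mD _ _] := Di.
  have ichi := ball_finite_integrable Di Cchi.
  have iphi := ball_finite_integrable Di Cphi.
  by rewrite RintegralD// ?RintegralZl//; [exact: integrableZl ichi|exact: integrableZl iphi].
have combE' s : (\int[nu]_y (M * chi y + s * phi y) =
     M * \int[nu]_y chi y + s * \int[nu]_y phi y)%R.
  have ichi := ball_finite_integrable (ball_finite_id nu_fin) Cchi.
  have iphi := ball_finite_integrable (ball_finite_id nu_fin) Cphi.
  by rewrite RintegralD// ?RintegralZl//; [exact: integrableZl ichi|exact: integrableZl iphi].
have /(testedE Df Cchi)/cvgrPdist_lt chi_cvg : tested D f chi.
  apply: (lipD 1) => //; [exact: lipschitz_cutoff|move=> y; exact: cutoff_ge0].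
apply/cvgrPdist_le => e e0.
have e2 : 0 < e / 2 by rewrite divr_gt0.
have eM : 0 < e / 2 / M by rewrite divr_gt0.
(* The integrals of [M * chi] converge, so lower bounds for [M * chi + phi] and [M * chi - phi]
   bound those of [phi] from below and above. *)
have Hp := lower _ _ e2 (Ccomb 1) (fun y => comb0 1 y (or_introl erefl)).
have Hm := lower _ _ e2 (Ccomb (-1)) (fun y => comb0 (-1) y (or_intror erefl)).
near=> i.
have Di : ball_finite (m i) (D i) (f i) by near: i.
have hp : (\int[nu]_y (M * chi y + 1 * phi y) - e / 2 <=
  \int[m i]_(x in D i) (M * chi (f i x) + 1 * phi (f i x)))%R by near: i.
have hm : (\int[nu]_y (M * chi y + -1 * phi y) - e / 2 <=
  \int[m i]_(x in D i) (M * chi (f i x) + -1 * phi (f i x)))%R by near: i.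
have : `|\int[nu]_y chi y - \int[m i]_(x in D i) chi (f i x)|%R < e / 2 / M.
  by near: i; exact: chi_cvg.
rewrite ltr_pdivlMr// mulrC => hchi.
have : `|M * (\int[nu]_y chi y) - M * (\int[m i]_(x in D i) chi (f i x))|%R < e / 2.
  by rewrite -mulrBr normrM gtr0_norm.
move: hp hm; rewrite !combE// !combE' ltr_norml => hp hm /andP[h1 h2].
rewrite ler_norml; apply/andP; split; lra.
Unshelve. all: by end_near. Qed.

End Sequences.

(** * Transferring weak convergence between close maps *)

Section Transfer.
Context {R : realType} {X : nat -> pmmSpace R} {Y : polishMetricType R}.
Context {nu : {measure set (borel Y) -> \bar R}}.
Hypothesis nu_fin : forall o r, (nu (ball o r) < +oo)%E.

Local Notation m i := (pmm_measure (X i)).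

Lemma ball_finite_close d (T : measurableType d) (mu : {measure set T -> \bar R})
    (A : set T) (f g : T -> Y) (phi chi : Y -> R) c :
  ball_finite mu A f -> ball_finite mu A g -> Cbbs phi -> Cbbs chi ->
  (forall x, A x -> `|phi (f x) - phi (g x)| <= c * chi (g x)) ->
  (`|\int[mu]_(x in A) phi (f x) - \int[mu]_(x in A) phi (g x)| <=
    c * \int[mu]_(x in A) chi (g x))%R.
Proof.
move=> Af Ag Cphi Cchi close; have [mA _ _] := Af.
have fphi := ball_finite_integrable Af Cphi.
have gphi := ball_finite_integrable Ag Cphi.
have gchi := ball_finite_integrable Ag Cchi.
rewrite -RintegralB// -RintegralZl//.
have isub : mu.-integrable A (fun x => (phi (f x) - phi (g x))%:E).
  exact: (integrableB mA fphi gphi).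
apply: le_trans (le_normr_Rintegral mA isub) _.
apply: le_Rintegral => //; last exact: (integrableZl mA _ gchi).
exact: (integrable_abse isub).
Qed.

(** For a [k]-Lipschitz [phi] bounded by [M], the integrands differ on [A i] by at most
    [k * e i * chi], and the parts off [A i] contribute at most [M * e i] each. The integrals of
    [chi] converge, so the total error [c i] tends to 0. *)
Lemma tested_transfer (D E A : forall i, set (borel (X i)))
    (f g : forall i, X i -> Y) (e : nat -> R) (o : Y) :
  (\forall i \near \oo, ball_finite (m i) (D i) (f i)) ->
  (\forall i \near \oo, ball_finite (m i) (E i) (g i)) ->
  e i @[i --> \oo] --> 0 ->
  (\forall i \near \oo, [/\ measurable (A i), A i `<=` D i, A i `<=` E i &
     forall x, A i x -> mdist (f i x) (g i x) <= e i]) ->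
  (forall r, \forall i \near \oo,
     (m i ((D i `\` A i) `&` f i @^-1` ball o r) <= (e i)%:E)%E) ->
  (forall r, \forall i \near \oo,
     (m i ((E i `\` A i) `&` g i @^-1` ball o r) <= (e i)%:E)%E) ->
  (forall phi, Cbbs phi -> tested (nu := nu) E g phi) ->
  forall phi, Cbbs phi -> tested (nu := nu) D f phi.
Proof.
move=> Df Eg e_cvg AP muD muE Egnu; apply: tested_lipschitz => // k phi k0 kphi Cphi phi0.
apply/testedE => //.
have [r [M [r0 M0 cphi Mphi rphi]]] := CbbsE o Cphi.
have Mphi' y : 0 <= phi y <= M.
  by rewrite phi0 (le_trans (ler_norm _) (Mphi y)).
(* If [phi] is nonzero at [f i x] or [g i x], then [g i x] is within [r + 1] of [o] as soon as
   [e i <= 1], and [chi] is 1 there. *)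
pose chi := cutoff o (r + 1).
have Cchi : Cbbs chi by exact: Cbbs_cutoff.
have /(testedE nu_fin Eg Cphi) phi_cvg := Egnu _ Cphi.
have /(testedE nu_fin Eg Cchi) chi_cvg := Egnu _ Cchi.
pose a i := (\int[m i]_(x in E i) phi (g i x))%R.
pose c i := e i * (M + k * (\int[m i]_(x in E i) chi (g i x)))%R.
have c_cvg : c i @[i --> \oo] --> 0.
  rewrite -[X in _ --> X](mul0r (M + k * (\int[nu]_y chi y)%R)).
  apply: cvgM => //; apply: cvgD; first exact: cvg_cst.
  by apply: cvgM => //; exact: cvg_cst.
apply: (@squeeze_cvgr _ _ _ _ (fun i => a i - c i) (fun i => a i + c i)); last 2 first.
- by rewrite -[X in _ --> X]subr0; exact: cvgB.
- by rewrite -[X in _ --> X]addr0; exact: cvgD.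
near=> i.
have Di : ball_finite (m i) (D i) (f i) by near: i.
have Ei : ball_finite (m i) (E i) (g i) by near: i.
have [mA AD AE fg] : [/\ measurable (A i), A i `<=` D i, A i `<=` E i &
     forall x, A i x -> mdist (f i x) (g i x) <= e i] by near: i.
have e1 : e i <= 1.
  have : `|0 - e i| < 1 by near: i; move/cvgrPdist_lt : e_cvg; apply.
  by rewrite sub0r normrN => /(le_lt_trans (ler_norm _))/ltW.
have Afi := ball_finiteS mA AD Di.
have Agi := ball_finiteS mA AE Ei.
have close x : A i x -> `|phi (f i x) - phi (g i x)| <= (k * e i) * chi (g i x).
  move=> Ax; have fgx := fg _ Ax.
  have [fx|fx] := eqVneq (phi (f i x)) 0; have [gx|gx] := eqVneq (phi (g i x)) 0.
  - rewrite fx gx subrr normr0 !mulr_ge0 ?cutoff_ge0//.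
    exact: le_trans (mdist_ge0 _ _) fgx.
  - apply: le_trans (lipschitz_with_dist _ _ kphi) _.
    rewrite -mulrA ler_wpM2l// /chi cutoff1 ?mulr1//.
    by have := rphi _ gx; lra.
  - apply: le_trans (lipschitz_with_dist _ _ kphi) _.
    rewrite -mulrA ler_wpM2l// /chi cutoff1 ?mulr1//.
    by have := rphi _ fx; have := metric_triangle o (f i x) (g i x); lra.
  - apply: le_trans (lipschitz_with_dist _ _ kphi) _.
    rewrite -mulrA ler_wpM2l// /chi cutoff1 ?mulr1//.
    by have := rphi _ gx; lra.
have := ball_finite_close Afi Agi Cphi Cchi close.
have chi_le : (\int[m i]_(x in A i) chi (g i x) <= \int[m i]_(x in E i) chi (g i x))%R.
  by apply: (ball_finite_subset Ei) => // y; exact: cutoff_ge0.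
have Dge := ball_finite_subset Di mA AD Cphi phi0.
have Ege := ball_finite_subset Ei mA AE Cphi phi0.
have Dle := ball_finite_split Di mA AD Cphi Mphi' rphi.
have {}Dle : (\int[m i]_(x in D i) phi (f i x) <=
    \int[m i]_(x in A i) phi (f i x) + M * e i)%R.
  by apply: Dle; near: i; exact: muD.
have Ele := ball_finite_split Ei mA AE Cphi Mphi' rphi.
have {}Ele : (\int[m i]_(x in E i) phi (g i x) <=
    \int[m i]_(x in A i) phi (g i x) + M * e i)%R.
  by apply: Ele; near: i; exact: muE.
(* The sign comes from [e i] bounding a measure; the radius 0 is arbitrary. *)
have e0 : 0 <= e i.
  have h : (m i ((D i `\` A i) `&` f i @^-1` ball o 0) <= (e i)%:E)%E.
    by near: i; exact: muD.
  by rewrite -lee_fin; apply: le_trans h; exact: measure_ge0.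
have ke_le : (k * e i) * (\int[m i]_(x in A i) chi (g i x))%R <=
             (k * e i) * (\int[m i]_(x in E i) chi (g i x))%R.
  by rewrite ler_wpM2l// mulr_ge0.
have cE : c i = M * e i + (k * e i) * (\int[m i]_(x in E i) chi (g i x))%R.
  by rewrite /c; ring.
rewrite -/(a i) in Ele Ege *.
rewrite cE ler_norml => /andP[h1 h2].
by apply/andP; split; lra.
Unshelve. all: by end_near. Qed.

End Transfer.

(** Equips the bare set function [pushforward mu f] with its measure structure, which depends on the
    proof [mf]. *)
Lemma pushforward_is_measure {R : realType} d d' (T1 : measurableType d)
    (T2 : measurableType d') (mu : {measure set T1 -> \bar R}) (f : T1 -> T2)
    (mf : measurable_fun setT f) :
  exists nu : {measure set T2 -> \bar R},
    (nu : set T2 -> \bar R) = pushforward mu f.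
Proof.
by exists
  (measure_function.measure_function_pushforward__canonical__measure_function_Measure mu mf).
Qed.

(** * Push-forwards along isometric embeddings *)

Section Isometric.
Context {R : realType}.

(** The centre [o] may lie off the image; a nonempty preimage of [ball o r] is contained in the ball
    of radius [r + r] around any of its points. *)
Lemma isometric_ball_finite (X : pmmSpace R) (Y : polishMetricType R)
    (iota : X -> Y) : boundedly_finite X -> isometric_embedding iota ->
  ball_finite (pmm_measure X) (setT : set (borel X)) iota.
Proof.
move=> Xfin iotaE; split => //.
  by apply: continuous_borel; exact: isometric_continuous.
move=> o r; rewrite setTI.
have [->|/set0P[x /= ox]] := eqVneq (iota @^-1` ball o r) set0.
  by rewrite measure0.
apply: le_lt_trans (Xfin x (r + r)); apply: le_measure; rewrite ?inE.
- have /(_ measurableT) := continuous_borel (isometric_continuous iotaE).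
  by move=> /(_ _ (borel_ball o r)); rewrite setTI.
- exact: borel_ball.
- move=> x' /=; move: ox; rewrite !ballEmdist /= => ox ox'.
  have := metric_triangle (iota x) o (iota x').
  rewrite iotaE (metric_sym (iota x)); lra.
Qed.

Lemma integral_pushforward_isometric (X : pmmSpace R) (Y : polishMetricType R)
    (iota : X -> Y) phi : boundedly_finite X -> isometric_embedding iota ->
  Cbbs phi ->
  (\int[pushforward (pmm_measure X) (iota : borel X -> borel Y)]_y
    (phi y)%:E = \int[pmm_measure X]_x (phi (iota x))%:E)%E.
Proof.
move=> Xfin iotaE Cphi; have [cphi _ _] := Cphi.
have miota := continuous_borel (isometric_continuous iotaE).
rewrite (integral_pushforward miota) ?preimage_setT//.
- by apply/measurable_EFinP; exact: continuous_borel_real.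
- exact: (ball_finite_integrable (isometric_ball_finite Xfin iotaE) Cphi).
Qed.

Lemma pushforward_measure (X : pmmSpace R) (Y : polishMetricType R)
    (iota : X -> Y) : boundedly_finite X -> isometric_embedding iota ->
  exists nu : {measure set (borel Y) -> \bar R},
  (nu : set (borel Y) -> \bar R) =
    pushforward (pmm_measure X) (iota : borel X -> borel Y) /\
  forall o r, (nu (ball o r) < +oo)%E.
Proof.
move=> Xfin iotaE.
have miota := continuous_borel (isometric_continuous iotaE).
have [nu nuE] := pushforward_is_measure (pmm_measure X) miota.
exists nu; split=> [//|o r]; rewrite nuE.
by have [_ _ /(_ o r)] := isometric_ball_finite Xfin iotaE; rewrite setTI.
Qed.

(** Turns the bound on the bad part of a ball of X into the mass condition of [tested_transfer] on
    the whole space. *)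
Lemma isometric_setD_le (X : pmmSpace R) (Y : polishMetricType R)
    (iota : X -> Y) (A : set (borel X)) (p : X) (o : Y) r s :
  boundedly_finite X -> isometric_embedding iota -> measurable A ->
  mdist (iota p) o + s <= r ->
  (pmm_measure X ((setT `\` A) `&` iota @^-1` ball o s) <=
    pmm_measure X (ball p r `\` A))%E.
Proof.
move=> Xfin iotaE mA psr; have [_ mi _] := isometric_ball_finite Xfin iotaE.
apply: le_measure; rewrite ?inE.
- apply: measurableI; first exact: measurableD.
  by rewrite -[X in measurable X]setTI; apply: mi => //; exact: borel_ball.
- by apply: measurableD => //; exact: borel_ball.
- move=> x [[_ nA]]; rewrite /= ballEmdist /= => sx; split => //.
  rewrite ballEmdist /= -iotaE.
  have := metric_triangle (iota p) o (iota x); lra.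
Qed.

End Isometric.

(** * From weak approximations to a common space *)

Section ApproximationLink.
Context {R : realType} {W Z : polishMetricType R}.
Context (A : set W) (q : W -> Z) (g : R).

(** Gluing along the pairs of [a] and [q a]; the summand [g] pays for the distortion of [q] and
    separates the two spaces. *)
Definition approx_link (x : W) (y : Z) : R :=
  inf ((fun a => mdist x a + mdist (q a) y + g) @` A).

Hypotheses (A0 : A !=set0) (g0 : 0 < g).
Hypothesis qg : forall x y, A x -> A y ->
  `|mdist x y - mdist (q x) (q y)| <= g.

Let ge0 x y a : 0 <= mdist x a + mdist (q a) y + g.
Proof. by rewrite !addr_ge0 ?mdist_ge0// ltW. Qed.

Lemma approx_link_le x y a : A a ->
  approx_link x y <= mdist x a + mdist (q a) y + g.
Proof. exact: inf_image_le. Qed.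

Lemma approx_link_gap x y : g <= approx_link x y.
Proof.
by apply: inf_image_ge => // a _; rewrite lerDr addr_ge0 ?mdist_ge0.
Qed.

Lemma approx_link_hub x y y' : approx_link x y <= approx_link x y' + mdist y y'.
Proof.
rewrite -lerBlDr; apply: inf_image_ge => // a Aa; rewrite lerBlDr.
apply: le_trans (approx_link_le x y Aa) _.
have := metric_triangle (q a) y' y; rewrite (metric_sym y' y); lra.
Qed.

Lemma approx_link_leg x x' y : approx_link x y <= approx_link x' y + mdist x x'.
Proof.
rewrite -lerBlDr; apply: inf_image_ge => // a Aa; rewrite lerBlDr.
apply: le_trans (approx_link_le x y Aa) _.
have := metric_triangle x x' a; lra.
Qed.

(** Going from [x] to [y] via [a] and back to [x'] via [b] pays [g] twice, while replacing
    [mdist (q a) (q b)] by [mdist a b] costs it only once. *)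
Lemma leg_le_approx_link x x' y :
  mdist x x' <= approx_link x y + approx_link x' y.
Proof.
rewrite -lerBlDr; apply: inf_image_ge => // a Aa.
rewrite lerBlDr -lerBlDl; apply: inf_image_ge => // b Ab; rewrite lerBlDl.
have := ltW g0; have := qg Aa Ab; rewrite ler_norml => /andP[_ h] g_ge0.
have := metric_triangle x a x'; have := metric_triangle a b x'.
have := metric_triangle (q a) y (q b).
rewrite (metric_sym b x') (metric_sym y); lra.
Qed.

Lemma hub_le_approx_link x y y' :
  mdist y y' <= approx_link x y + approx_link x y'.
Proof.
rewrite -lerBlDr; apply: inf_image_ge => // a Aa.
rewrite lerBlDr -lerBlDl; apply: inf_image_ge => // b Ab; rewrite lerBlDl.
have := ltW g0; have := qg Aa Ab; rewrite ler_norml => /andP[h _] g_ge0.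
have := metric_triangle y (q a) y'; have := metric_triangle (q a) (q b) y'.
have := metric_triangle a x b.
rewrite (metric_sym y (q a)) (metric_sym a x); lra.
Qed.

End ApproximationLink.

Section WeakApproximationToGromov.
Context {R : realType} (X : nat -> pmmSpace R) (Xoo : pmmSpace R).
Hypothesis X_bf : forall i : nat, boundedly_finite (X i).
Hypothesis Xoo_bf : boundedly_finite Xoo.

Local Notation p i := (pmm_base (X i)).
Local Notation poo := (pmm_base Xoo).
Local Notation m i := (pmm_measure (X i)).

(** The star needs a link at every index, so this keeps only what can also be supplied where no weak
    approximation exists. *)
Record approx_data i := ApproxData {
  ad_set : set (X i) ;
  ad_map : X i -> Xoo ;
  ad_err : R ;
  ad_base : ad_set (p i) ;
  ad_err_gt0 : 0 < ad_err ;
  ad_close : forall x y, ad_set x -> ad_set y ->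
    `|mdist x y - mdist (ad_map x) (ad_map y)| <= ad_err }.

(* For the finitely many indices without a weak approximation, any [ad_set]
   works; a single point suffices. *)
Lemma approx_data_exists (r e : nat -> R) (psi : forall i, X i -> Xoo) i :
  exists a : approx_data i, weak_approximation (r i) (e i) (psi i) ->
    [/\ ad_map a = psi i, ad_err a = e i,
        measurable (ad_set a : set (borel (X i))),
        ad_set a `<=` ball (p i) (r i) &
        (m i (ball (p i) (r i) `\` ad_set a) <= (e i)%:E)%E].
Proof.
have [[/andP[e0 er] mpsi psip [A [mA Ar Ap Ae [muA _]]]]|no] :=
    pselect (weak_approximation (r i) (e i) (psi i)).
  by exists (@ApproxData i A (psi i) (e i) Ap e0 Ae).
have close x y : [set p i] x -> [set p i] y ->
    `|mdist x y - mdist poo poo| <= 1 by move=> -> ->; rewrite !mdistxx subrr normr0.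
by exists (@ApproxData i [set p i] (fun=> poo) 1 erefl ltr01 close).
Qed.

Lemma wpmGH_pmG : wpmGH_cvg X Xoo -> pmG_cvg X Xoo.
Proof.
move=> [r [e [psi [[r_nd r_cvg] [e_ni e_cvg] weak psi_cvg]]]].
pose a i := sval (cid (approx_data_exists r e psi i)).
have aP i : weak_approximation (r i) (e i) (psi i) ->
    [/\ ad_map (a i) = psi i, ad_err (a i) = e i,
        measurable (ad_set (a i) : set (borel (X i))),
        ad_set (a i) `<=` ball (p i) (r i) &
        (m i (ball (p i) (r i) `\` ad_set (a i)) <= (e i)%:E)%E].
  exact: (svalP (cid (approx_data_exists r e psi i))).
have a0 i : ad_set (a i) !=set0 by exists (p i); exact: ad_base.
pose lnk i := approx_link (ad_set (a i)) (ad_map (a i)) (ad_err (a i)).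
have g0 i := ad_err_gt0 (a i).
have lnk_gap i x y : ad_err (a i) <= lnk i x y by exact: approx_link_gap.
have lnk_hub i x y y' : lnk i x y <= lnk i x y' + mdist y y'.
  exact: approx_link_hub.
have lnk_leg i x x' y : lnk i x y <= lnk i x' y + mdist x x'.
  exact: approx_link_leg.
have leg_lnk i x x' y : mdist x x' <= lnk i x y + lnk i x' y.
  exact: (leg_le_approx_link (a0 i) (g0 i) (@ad_close _ (a i))).
have hub_lnk i x y y' : mdist y y' <= lnk i x y + lnk i x y'.
  exact: (hub_le_approx_link (a0 i) (g0 i) (@ad_close _ (a i))).
pose S := Star g0 lnk_gap lnk_hub lnk_leg leg_lnk hub_lnk.
pose Y := glue_polish S.
pose iota i : X i -> Y := @of_leg R S i.
pose iotaoo : Xoo -> Y := @of_hub R S.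
have iotaE i : isometric_embedding (iota i) := @isometric_of_leg R S i.
have iotaooE : isometric_embedding iotaoo := @isometric_of_hub R S.
(* Taking [x] itself as the gluing point leaves only the summand [e i]. *)
have near_map i x : weak_approximation (r i) (e i) (psi i) -> ad_set (a i) x ->
    mdist (iota i x) (iotaoo (psi i x)) <= e i.
  move=> /aP[<- <- _ _ _] Ax; rewrite /iota /iotaoo (@mdist_leg_hub R S i).
  have := @approx_link_le _ _ _ _ (ad_map (a i)) _ (g0 i) x (ad_map (a i) x) x Ax.
  by rewrite !mdistxx !add0r.
have near_base i : weak_approximation (r i) (e i) (psi i) ->
    mdist (iota i (p i)) (iotaoo poo) <= e i.
  move=> w; have [_ _ <- _] := w; apply: near_map => //; exact: ad_base.
exists Y, iota, iotaoo; split => //.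
  apply: (@squeeze_cvgr _ _ _ _ (fun=> 0) e) => //; last exact: cvg_cst.
  by near=> i; rewrite mdist_ge0 near_base//; near: i.
have [nu [nuE nu_fin]] := pushforward_measure Xoo_bf iotaooE.
have iota_fin i := isometric_ball_finite (@X_bf i) (iotaE i).
pose D i : set (borel (X i)) := setT.
pose E i : set (borel (X i)) := ball (p i) (r i).
have psi_fin i : weak_approximation (r i) (e i) (psi i) ->
    ball_finite (m i) (E i) (iotaoo \o psi i).
  move=> [_ mpsi _ _].
  apply: ball_finite_finite; [exact: borel_ball|exact: (@X_bf i)|].
  apply: (@measurableT_comp _ _ _ _ (borel Xoo) (borel Y)) mpsi.
  by apply: continuous_borel; exact: isometric_continuous.
move=> phi Cphi; rewrite -nuE.
have -> : (fun i => (\int[pushforward (m i) (iota i : borel (X i) -> borel Y)]_y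
      (phi y)%:E)%E) = (fun i => (\int[m i]_(x in D i) (phi (iota i x))%:E)%E).
  by apply/funext => i; exact: integral_pushforward_isometric.
rewrite -/(tested (nu := nu) D iota phi).
apply: (@tested_transfer _ _ _ _ nu_fin D E (fun i => ad_set (a i)) iota
  (fun i => iotaoo \o psi i) e (iotaoo poo)) => //.
- by near=> i.
- by near=> i; apply: psi_fin; near: i.
- near=> i; have w : weak_approximation (r i) (e i) (psi i) by near: i.
  have [_ _ mA Ar _] := aP _ w; split => // x Ax; exact: near_map.
- move=> s; near=> i; have w : weak_approximation (r i) (e i) (psi i) by near: i.
  have [_ _ mA Ar muA] := aP _ w; apply: le_trans muA.
  apply: isometric_setD_le => //.
  (* The base points are within [e i <= e 0] of each other, so the ball of radius [s] around the
     limit base point pulls back into the ball of radius [r i]. *)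
  have : s + e 0%N <= r i by near: i; move/cvgryPge : r_cvg; apply.
  have := near_base _ w; have := e_ni 0%N i (leq0n i); lra.
- move=> s; near=> i; have w : weak_approximation (r i) (e i) (psi i) by near: i.
  have [_ _ mA Ar muA] := aP _ w; apply: le_trans muA.
  by apply: ball_finite_setD_le => //; exact: psi_fin.
- move=> f Cf; rewrite /tested nuE integral_pushforward_isometric//.
  exact: (psi_cvg _ (Cbbs_comp iotaooE Cf)).
Unshelve. all: by end_near. Qed.

End WeakApproximationToGromov.

(** * Selection, extension and diagonal choice *)

(** Starting at [o] lets a first-hit selection send base point to base point. *)
Lemma dense_sequence {R : realType} (Z : polishMetricType R) (o : Z) :
  exists y : nat -> Z, y 0 = o /\
    forall z e, 0 < e -> exists k, mdist z (y k) < e.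
Proof.
have [D /countable_injP[f finj] dD] := @separable R Z.
(* Codes shift by one to make room for [o], which is also the default for a code that no point of
   [D] has. *)
pose y n := if n is n'.+1 then xget o [set z | D z /\ f z = n'] else o.
exists y; split => // z e e0.
have [|u [zu Du]] := dD (interior (ball z e)) _ (@open_interior _ _).
  by exists z; rewrite /interior; exact: nbhsx_ballx.
exists (f u).+1 => /=.
have [Du' fu'] : [set z | D z /\ f z = f u] (xget o [set z | D z /\ f z = f u]).
  by apply: xgetPex; exists u.
have -> : xget o [set z | D z /\ f z = f u] = u by apply: finj; rewrite ?inE.
by move/interior_subset : zu; rewrite ballEmdist.
Qed.

Section Selection.
Context {R : realType} {X Z Y : polishMetricType R}.
Context (iota : X -> Y) (kappa : Z -> Y).
Hypotheses (iotaE : isometric_embedding iota).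

(** [q] takes the first term of a dense sequence that lies within [d]. It is constant on the
    countably many disjointed sets [seqDU V k], hence Borel, and [U] is the union of the open sets
    [V k]. *)
Lemma near_selection (x0 : X) (z0 : Z) d :
  mdist (iota x0) (kappa z0) < d -> isometric_embedding kappa ->
  exists (q : X -> Z) (U : set X), [/\ open U,
    measurable_fun (setT : set (borel X)) (q : borel X -> borel Z),
    q x0 = z0 /\ U x0,
    forall x, U x -> mdist (iota x) (kappa (q x)) < d &
    forall x z, mdist (iota x) (kappa z) < d -> U x].
Proof.
move=> xz0 kappaE.
have [y [y0 ydense]] := dense_sequence z0.
pose V k : set (borel X) := iota @^-1` ball (kappa (y k)) d.
have oV k : open (V k : set X).
  apply: open_comp; last exact: metric_open_ball.
  by move=> x _; exact: isometric_continuous.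
have VE k x : V k x <-> mdist (iota x) (kappa (y k)) < d.
  by rewrite /V /= ballEmdist /= metric_sym.
have mV k : measurable (V k) by exact: borel_open.
pose N x := xget 0%N [set k | seqDU V k x].
have NV x : (\bigcup_k V k) x -> seqDU V (N x) x.
  rewrite (seqDU_bigcup_eq V) => -[k _ Vk].
  by apply: (@xgetPex _ 0%N [set k | seqDU V k x]); exists k.
have Nuniq x k : seqDU V k x -> N x = k.
  move=> Vk; have Ux : (\bigcup_k V k) x by rewrite (seqDU_bigcup_eq V); exists k.
  by apply: (@trivIset_seqDU _ V _ _ I I); exists x; split => //; exact: NV.
have Nout x : ~ (\bigcup_k V k) x -> N x = 0%N.
  move=> nU; rewrite /N; case: xgetP => // k _ /= Vk.
  by exfalso; apply: nU; rewrite (seqDU_bigcup_eq V); exists k.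
have mS k : measurable (seqDU V k).
  by apply: measurableD => //; apply: bigsetU_measurable.
exists (y \o N), (\bigcup_k V k); split.
- exact: bigcup_open.
- move=> _ B mB; rewrite setTI.
  (* Outside the union of the [V k] the default index 0 is taken, so the complement counts exactly
     when [y 0] is in [B]. *)
  have -> : (y \o N) @^-1` B =
      \bigcup_(k in [set k | B (y k)]) seqDU V k `|`
      (if pselect (B (y 0%N)) then ~` (\bigcup_k V k) else set0).
    apply/seteqP; split => x.
      have [Ux|nUx] := pselect ((\bigcup_k V k) x) => /= Bx.
        by left; exists (N x) => //; exact: NV.
      by right; case: pselect => // nB; move: Bx; rewrite (Nout _ nUx).
    move=> [[k /= Bk /Nuniq ->//]|]; case: pselect => // B0 nUx /=.
    by rewrite (Nout _ nUx).
  apply: measurableU; first by apply: bigcup_measurable => k _.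
  case: pselect => [?|?] //=; apply: measurableC.
  by apply: bigcup_measurable => k _.
- have V0 : V 0%N x0 by apply/VE; rewrite y0.
  split; last by exists 0%N.
  have -> /= : (y \o N) x0 = y (N x0) by [].
  rewrite (Nuniq _ 0%N)//; split => //; rewrite big_ord0; exact.
- by move=> x /NV[/VE].
- move=> x z xz; have [k zk] := ydense z (d - mdist (iota x) (kappa z)) ltac:(by rewrite subr_gt0).
  exists k => //; apply/VE; have := metric_triangle (iota x) (kappa z) (kappa (y k)).
  rewrite kappaE; lra.
Qed.

End Selection.

Lemma lipschitz_scale {R : realType} (T : metricType R) c k (f : T -> R) :
  0 <= c -> lipschitz_with k f -> lipschitz_with (c * k) (fun x => c * f x).
Proof. by move=> c0 fk x y; rewrite -mulrA -mulrDr ler_wpM2l. Qed.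

(** The McShane extension is capped by [M * cutoff o r] to have bounded support; on the image the
    cap exceeds [phi] and changes nothing. *)
Lemma lipschitz_extension {R : realType} (Z Y : polishMetricType R)
    (kappa : Z -> Y) k (phi : Z -> R) :
  isometric_embedding kappa -> 0 <= k -> lipschitz_with k phi ->
  Cbbs phi -> (forall z, 0 <= phi z) ->
  exists2 Phi : Y -> R, Cbbs Phi & forall z, Phi (kappa z) = phi z.
Proof.
move=> kappaE k0 kphi Cphi phi0.
have [r [M [r0 M0 cphi Mphi rphi]]] := CbbsE point Cphi.
pose o := kappa point.
pose Phi y := Num.min (envelope kappa phi k y) (M * cutoff o r y).
have Phi01 y : 0 <= Phi y <= M * cutoff o r y.
  by rewrite le_min envelope_ge0// mulr_ge0 ?cutoff_ge0 ?(ltW M0)//= ge_min lexx orbT.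
exists Phi.
  apply: (@CbbsI _ _ Phi o (r + 1) M).
  - apply: (@lipschitz_continuous _ _ (Num.max k M)); apply: lipschitz_min.
      by apply: lipschitz_with_le (lipschitz_envelope _ phi0 k0); rewrite le_max lexx.
    apply: lipschitz_with_le (lipschitz_scale (ltW M0) (@lipschitz_cutoff _ _ o r)).
    by rewrite mulr1 le_max lexx orbT.
  - move=> y; have /andP[P0 PM] := Phi01 y; rewrite ger0_norm//.
    by apply: le_trans PM _; rewrite ler_piMr ?cutoff_le1// ltW.
  - move=> y Py; apply: cutoff_neq0; apply: contra Py => /eqP c0.
    by have := Phi01 y; rewrite c0 mulr0 -eq_le eq_sym.
move=> z; rewrite /Phi envelope_lipschitz//; apply/min_idPl.
have [->|zr] := eqVneq (phi z) 0; first by rewrite mulr_ge0 ?cutoff_ge0// ltW.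
rewrite cutoff1 ?mulr1; first exact: le_trans (ler_norm _) (Mphi z).
by rewrite kappaE; apply: ltW; exact: rphi.
Qed.

(** [s i] is the largest [n <= i] such that [i] has passed the thresholds of all [k <= n]. *)
Lemma near_diagonal (P : nat -> nat -> Prop) :
  (forall n, \forall i \near \oo, P n i) ->
  exists s : nat -> nat, [/\ {homo s : i j / (i <= j)%N},
    s i @[i --> \oo] --> \oo & \forall i \near \oo, P (s i) i].
Proof.
move=> nP.
have [N NP] : exists N : nat -> nat, forall n i, (N n <= i)%N -> P n i.
  have H n : exists N0, forall i, (N0 <= i)%N -> P n i.
    by have [N0 _ H] := nP n; exists N0 => i /H.
  by have [N NP] := choice H; exists N.
pose ok i n := [forall k : 'I_n.+1, (N k <= i)%N].
pose s i := (\max_(n < i.+1 | ok i n) n)%N.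
have s_ge i n : (n <= i)%N -> ok i n -> (n <= s i)%N.
  move=> ni oki; rewrite -ltnS in ni.
  exact: (@leq_bigmax_cond _ (fun n : 'I_i.+1 => ok i n) _ (Ordinal ni)).
exists s; split.
- move=> i j ij; apply/bigmax_leqP => n oki; apply: s_ge.
    by apply: leq_trans ij; rewrite -ltnS.
  by apply/forallP => k; apply: leq_trans ij; move/forallP : oki; apply.
- apply/cvgnyPge => M.
  exists (maxn M (\max_(k < M.+1) N k)) => // i /=; rewrite geq_max => /andP[Mi Ni].
  apply: s_ge => //; apply/forallP => k; apply: leq_trans Ni.
  exact: leq_bigmax_cond.
(* From [N 0] on, the index 0 is admissible, so the maximum is attained; an empty maximum would only
   be a default 0. *)
- exists (N 0%N) => // i /= Ni.
  have [|n] := @eq_bigmax_cond _ (fun n : 'I_i.+1 => ok i n) (fun n : 'I_i.+1 => n : nat).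
    apply/card_gt0P; exists ord0; apply/forallP => k /=.
    by rewrite (ord1 k).
  move=> oki sE; rewrite /s -[X in P X]/(s i).
  have -> : s i = n by rewrite /s sE.
  apply: NP; move/forallP : oki => /(_ ord_max); exact.
Qed.

(** * From a common space to weak approximations *)

Section Positive.
Context {R : realType} {d : measure_display} {X : measurableType d}.
Context {mu : {measure set X -> \bar R}} {Y : polishMetricType R}.
Context {D : set X} {f : X -> Y} (Df : ball_finite mu D f).
Context {phi : Y -> R} (Cphi : Cbbs phi) (phi0 : forall y, 0 <= phi y).

Let mD : measurable D. Proof. by case: Df. Qed.

Let mphi : measurable_fun D (EFin \o (phi \o f)).
Proof. by apply/measurable_EFinP; exact: (ball_finite_measurable Df). Qed.

Lemma measure_le_Rintegral (B : set X) : measurable B -> B `<=` D ->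
  (forall x, B x -> 1 <= phi (f x)) ->
  (mu B <= (\int[mu]_(x in D) phi (f x))%R%:E)%E.
Proof.
move=> mB BD phi1; rewrite -(ball_finite_integralE Df)//.
apply: (@le_trans _ _ (\int[mu]_(x in B) (phi (f x))%:E)%E); last first.
  by apply: ge0_subset_integral => // x _; rewrite lee_fin.
rewrite -[leLHS]mul1e -integral_cst//; apply: ge0_le_integral => //.
exact: measurable_funS mD BD mphi.
Qed.

Lemma Rintegral_gt0_ex : 0 < (\int[mu]_(x in D) phi (f x))%R ->
  exists x, 0 < phi (f x).
Proof.
apply: contraPP => /forallNP nex; rewrite (@eq_Rintegral _ _ _ _ _ (cst 0)).
  by rewrite Rintegral_cst// mul0r ltxx.
move=> x _; apply/eqP; rewrite eq_le phi0 andbT leNgt; apply/negP; exact: nex.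
Qed.

(** A zero integral would make the integrand vanish almost everywhere, and [B] negligible. *)
Lemma Rintegral_gt0 (B : set X) : measurable B -> B `<=` D ->
  (forall x, B x -> 0 < phi (f x)) -> mu B != 0%E ->
  0 < (\int[mu]_(x in D) phi (f x))%R.
Proof.
move=> mB BD Bphi; apply: contraNT; rewrite -leNgt => int_le0.
have int0 : (\int[mu]_(x in D) `|(phi (f x))%:E| = 0)%E.
  rewrite (eq_integral (fun x => (phi (f x))%:E)); last first.
    by move=> x _; rewrite gee0_abs// lee_fin.
  rewrite (ball_finite_integralE Df)//; congr EFin.
  by apply/eqP; rewrite eq_le int_le0 ball_finite_ge0.
have /(ae_eq_integral_abs _ mD mphi) ae0 := int0.
apply/eqP; apply: measure_negligible => //.
apply: negligibleS ae0 => x Bx /= /(_ (BD _ Bx)) [] phi_eq.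
by have := Bphi _ Bx; rewrite phi_eq ltxx.
Qed.

End Positive.

Section GromovToWeakApproximation.
Context {R : realType} (X : nat -> pmmSpace R) (Xoo : pmmSpace R).
Hypothesis X_bf : forall i : nat, boundedly_finite (X i).
Hypothesis Xoo_bf : boundedly_finite Xoo.

Local Notation p i := (pmm_base (X i)).
Local Notation poo := (pmm_base Xoo).
Local Notation m i := (pmm_measure (X i)).
Local Notation moo := (pmm_measure Xoo).

Context {Y : polishMetricType R} (iota : forall i, X i -> Y) (kappa : Xoo -> Y).
Arguments iota : clear implicits.
Hypothesis iotaE : forall i, isometric_embedding (iota i).
Hypothesis kappaE : isometric_embedding kappa.
Hypothesis base_cvg :
  mdist (iota i (p i)) (kappa poo) @[i --> \oo] --> (0 : R).
Hypothesis test_cvg : forall phi : Y -> R, Cbbs phi ->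
  (\int[m i]_x phi (iota i x))%R @[i --> \oo] -->
  (\int[moo]_z phi (kappa z))%R.

Let o := kappa poo.

Lemma near_base d : 0 < d -> \forall i \near \oo, mdist (iota i (p i)) o < d.
Proof.
move=> d0; move/cvgrPdist_lt : base_cvg => /(_ _ d0).
by apply: filterS => i; rewrite sub0r normrN ger0_norm ?mdist_ge0.
Qed.

Let iota_fin i : ball_finite (m i) (setT : set (borel (X i))) (iota i).
Proof. exact: isometric_ball_finite (@X_bf i) (@iotaE i). Qed.

Let kappa_fin : ball_finite moo (setT : set (borel Xoo)) kappa.
Proof. exact: isometric_ball_finite Xoo_bf kappaE. Qed.

(** The truncated distance [phi] vanishes on the image of [kappa], so its integrals tend to 0, and
    it is at least 1 on every such [B]: the bound is uniform in [B]. *)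
Lemma mass_near_hub r d e : 0 < d -> 0 < e ->
  \forall i \near \oo, forall B : set (borel (X i)), measurable B ->
    B `<=` ball (p i) r ->
    (forall x z, B x -> d <= mdist (iota i x) (kappa z)) ->
    (m i B <= e%:E)%E.
Proof.
(* The envelope of 0 with slope [d^-1] is the distance to the image of [kappa] divided by [d]. *)
move=> d0 e0; pose h := envelope kappa (fun=> 0) d^-1.
have dV0 : 0 <= d^-1 by rewrite invr_ge0 ltW.
have h0 y : 0 <= h y by exact: envelope_ge0.
pose phi y := Num.min (h y) (cutoff o (r + 1) y).
have phi01 y : 0 <= phi y <= cutoff o (r + 1) y.
  by rewrite le_min h0 cutoff_ge0 ge_min lexx orbT.
have Cphi : Cbbs phi.
  apply: (@CbbsI _ _ phi o (r + 1 + 1) 1).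
  - apply: (@lipschitz_continuous _ _ (Num.max d^-1 1)); apply: lipschitz_min.
      apply: (@lipschitz_with_le _ _ d^-1); first by rewrite le_max lexx.
      exact: lipschitz_envelope.
    apply: (@lipschitz_with_le _ _ 1); first by rewrite le_max lexx orbT.
    exact: lipschitz_cutoff.
  - move=> y; have /andP[P0 PM] := phi01 y; rewrite ger0_norm//.
    exact: le_trans PM (cutoff_le1 _ _ _).
  - move=> y Py; apply: cutoff_neq0; apply: contra Py => /eqP c0.
    by have := phi01 y; rewrite c0 -eq_le eq_sym.
have phi0 y : 0 <= phi y by case/andP: (phi01 y).
have phi_kappa z : phi (kappa z) = 0.
  apply/eqP; rewrite eq_le phi0 andbT ge_min; apply/orP; left.
  exact: (@envelope_le _ _ _ kappa (fun=> 0)).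
have := test_cvg Cphi.
have -> : (\int[moo]_z phi (kappa z) = 0)%R.
  rewrite (@eq_Rintegral _ _ _ _ _ (cst 0)); first by rewrite Rintegral_cst// mul0r.
  by move=> z _; rewrite phi_kappa.
move=> /cvgrPdist_lt/(_ _ e0) int_cvg.
near=> i => B mB Bball Bfar.
have base1 : mdist (iota i (p i)) o < 1 by near: i; exact: near_base.
have : `|0 - \int[m i]_x phi (iota i x)|%R < e by near: i.
rewrite sub0r normrN => /(le_lt_trans (ler_norm _))/ltW int_le.
apply: le_trans (measure_le_Rintegral (iota_fin i) Cphi phi0 mB _ _) _ => //.
move=> x Bx; rewrite le_min; apply/andP; split; last first.
  rewrite cutoff1//; have := Bball _ Bx; rewrite ballEmdist /= -(@iotaE i).
  have := metric_triangle o (iota i (p i)) (iota i x).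
  rewrite (metric_sym o (iota i (p i))); lra.
apply: inf_image_ge => [|z _]; first by exists point.
by rewrite add0r mulrC ler_pdivlMr// mul1r; exact: Bfar.
Unshelve. all: by end_near. Qed.

(** [phi] is positive exactly on the intersection of the two balls of Y. Its limit integral is
    positive, so eventually those over [X i] are too. *)
Lemma near_meets z d r : moo (ball z d `&` ball poo r) != 0%E ->
  \forall i \near \oo, exists x, mdist (iota i x) (kappa z) < d /\
    mdist o (iota i x) < r.
Proof.
move=> nz.
pose phi y := Num.max 0 (Num.min (d - mdist (kappa z) y) (r - mdist o y)).
have phi0 y : 0 <= phi y by rewrite le_max lexx.
have phi_gt0 y : 0 < phi y <-> mdist (kappa z) y < d /\ mdist o y < r.
  rewrite lt_max ltxx /= lt_min !subr_gt0; split; first by move/andP.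
  by move=> [-> ->].
have Cphi : Cbbs phi.
  apply: (@CbbsI _ _ phi o r `|d|).
  - apply: (@lipschitz_continuous _ _ 1) => x y; rewrite mul1r ge_max.
    rewrite addr_ge0 ?mdist_ge0//=; apply: le_trans (_ : _ <=
        Num.min (d - mdist (kappa z) y) (r - mdist o y) + mdist x y) _; last first.
      by rewrite lerD2r le_max lexx orbT.
    rewrite addr_minl le_min; apply/andP; split; rewrite ge_min; apply/orP.
      by left; have := metric_triangle (kappa z) x y; lra.
    by right; have := metric_triangle o x y; lra.
  - move=> y; rewrite (ger0_norm (phi0 y)) /phi /= ge_max normr_ge0 ge_min; apply/orP; left.
    by have := mdist_ge0 (kappa z) y; have := ler_norm d; lra.
  - by move=> y py; have /phi_gt0[] : 0 < phi y by rewrite lt_neqAle eq_sym py phi0.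
have mB : measurable (ball z d `&` ball poo r : set (borel Xoo)).
  by apply: measurableI; exact: borel_ball.
have int_gt0 : 0 < (\int[moo]_z phi (kappa z))%R.
  apply: (Rintegral_gt0 kappa_fin Cphi phi0 mB) => // w.
  by rewrite !ballEmdist /= -!(kappaE _ w) => ?; apply/phi_gt0.
move/cvgrPdist_lt : (test_cvg Cphi) => /(_ _ int_gt0); apply: filterS => i.
rewrite ltr_norml => /andP[_ h].
have /(Rintegral_gt0_ex (iota_fin i) phi0)[x /phi_gt0[zx ox]] :
    0 < (\int[m i]_x phi (iota i x))%R by lra.
by exists x; split => //; rewrite metric_sym.
Qed.

Lemma near_forall_lt (Q : nat -> nat -> Prop) n :
  (forall k, \forall i \near \oo, Q k i) ->
  \forall i \near \oo, forall k, (k < n)%N -> Q k i.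
Proof.
move=> HQ; elim: n => [|n IH]; first by near=> i.
near=> i => k; rewrite ltnS leq_eqVlt => /orP[/eqP ->|kn]; first by near: i.
by move: k kn; near: i.
Unshelve. all: by end_near. Qed.

(** [weak_approximation] hides its good set behind an existential; the transfer of integrals needs
    an explicit one, with closeness measured in Y. *)
Definition close_approximation r e i (q : X i -> Xoo) (A : set (borel (X i))) :=
  [/\ weak_approximation r e q, measurable A, A `<=` ball (p i) r,
      (forall x, A x -> mdist (iota i x) (kappa (q x)) <= e) &
      (m i (ball (p i) r `\` A) <= e%:E)%E].

(** The uncovered sets decrease with [n]. A point in all of them lies only in balls meeting
    [ball poo r] in a null set, so their intersection is null, and continuity from above applies on
    a ball of finite mass. *)
Lemma finite_cover (y : nat -> Xoo) r d e : 0 < e ->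
  (forall z, exists k, mdist z (y k) < d) ->
  exists n, (moo (ball poo r `\` \bigcup_(k in [set k | (k < n)%N /\
    moo (ball (y k) d `&` ball poo r) != 0%E]) ball (y k) d) <= e%:E)%E.
Proof.
move=> e0 ydense.
pose G k : set (borel Xoo) := ball (y k) d `&` ball poo r.
have mb z s : measurable (ball z s : set (borel Xoo)) by exact: borel_ball.
have mG k : measurable (G k) by exact: measurableI.
pose F n : set (borel Xoo) := ball poo r `\` \bigcup_(k in [set k | (k < n)%N /\
    moo (G k) != 0%E]) ball (y k) d.
have mF n : measurable (F n).
  by apply: measurableD => //; apply: bigcup_measurable => k _.
have mcap : measurable (\bigcap_n F n) by exact: bigcapT_measurable.
have cap0 : moo (\bigcap_n F n) = 0%E.
  apply: measure_negligible => //.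
  apply: (@negligibleS _ _ _ _ (\bigcup_k (if moo (G k) == 0%E then G k else set0))).
    move=> z Fz; have [k zk] := ydense z.
    have [zr _] := Fz 0%N I.
    have Gz : G k z by split => //; rewrite ballEmdist /= metric_sym.
    exists k => //; case: ifPn => // Gk; have [_] := Fz k.+1 I.
    by case; exists k => //; case: Gz.
  apply: negligible_bigcup => k; case: ifPn => [/eqP Gk|_]; last exact: negligible_set0.
  by apply/negligibleP.
have F_cvg : (moo \o F) x @[x --> \oo] --> 0%E.
  rewrite -cap0; apply: nonincreasing_cvg_mu => //.
    apply: le_lt_trans (Xoo_bf poo r); apply: le_measure; rewrite ?inE//.
    exact: subDsetl.
  move=> n n' nn'; apply/subsetPset; apply: setDS => z [k [kn Gk] zk].
  by exists k => //; split => //; exact: leq_trans kn nn'.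
have [fin /cvgrPdist_lt/(_ _ e0) small] := (@fine_cvgP _ _ _ _ _ _).1 F_cvg.
near \oo => n; exists n; rewrite -/(F n).
have fn : moo (F n) \is a fin_num by near: n.
have : `|0 - fine (moo (F n))| < e by near: n.
rewrite sub0r normrN => /(le_lt_trans (ler_norm _))/ltW.
by rewrite -lee_fin fineK.
Unshelve. all: by end_near. Qed.

(** The good set consists of the points of the ball within [d = e / 4] of the limit space. There [q]
    moves points by less than [d] in Y, so distances change by less than [2 * d]. *)
Lemma near_weak_approximation r e : 0 < e < r -> \forall i \near \oo,
  exists qA : (X i -> Xoo) * set (borel (X i)),
    close_approximation r e qA.1 qA.2.
Proof.
move=> /andP[e0 er]; pose d := e / 4; have d0 : 0 < d by rewrite divr_gt0.
have [y [_ ydense]] := dense_sequence poo.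
have [n cover] := finite_cover (r - e) e0 (fun z => ydense z d d0).
have meets k : \forall i \near \oo, moo (ball (y k) d `&` ball poo (r - e)) != 0%E ->
    exists x, mdist (iota i x) (kappa (y k)) < d /\ mdist o (iota i x) < r - e.
  have [G0|Gn0] := eqVneq (moo (ball (y k) d `&` ball poo (r - e))) 0%E.
    by near=> i.
  by have := near_meets Gn0; apply: filterS => i + _.
have {}meets := near_forall_lt n meets.
near=> i.
have base_d : mdist (iota i (p i)) o < d by near: i; exact: near_base.
have [q [W [oW mq [qp Wp] Wq qW]]] := near_selection (@iotaE i) base_d kappaE.
pose A : set (borel (X i)) := ball (p i) r `&` W.
have mball : measurable (ball (p i) r : set (borel (X i))) by exact: borel_ball.
have mA : measurable A by apply: measurableI => //; exact: borel_open.
have dE : d * 4 = e by rewrite /d divfK.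
have muA : (m i (ball (p i) r `\` A) <= e%:E)%E.
  have far : forall B : set (borel (X i)), measurable B -> B `<=` ball (p i) r ->
      (forall x z, B x -> d <= mdist (iota i x) (kappa z)) -> (m i B <= e%:E)%E.
    by near: i; exact: mass_near_hub.
  apply: far; [exact: measurableD|exact: subDsetl|move=> x z [xr nA]].
  by rewrite leNgt; apply/negP => xz; apply: nA; split => //; exact: qW xz.
exists (q, A) => /=; split => //=.
- split=> //; first by rewrite e0.
    exact: measurable_funTS.
  exists A; split => //.
  + exact: subIsetl.
  + by split => //; apply: ballxx; lra.
  + move=> x x' [_ /Wq qx] [_ /Wq qx']; rewrite -(@iotaE i) -kappaE.
    have := metric_triangle (iota i x) (kappa (q x)) (iota i x').
    have := metric_triangle (kappa (q x)) (kappa (q x')) (iota i x').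
    have := metric_triangle (kappa (q x)) (iota i x) (kappa (q x')).
    have := metric_triangle (iota i x) (iota i x') (kappa (q x')).
    rewrite (metric_sym (kappa (q x)) (iota i x)).
    rewrite (metric_sym (kappa (q x')) (iota i x')).
    by rewrite ler_norml => *; apply/andP; split; lra.
  + split => //; apply: le_trans cover; apply: le_measure; rewrite ?inE.
    * apply: measurableD; first exact: borel_ball.
      have -> : enlargement (q @` A) e = \bigcup_(a in q @` A) ball a e.
        apply/seteqP; split => z.
          move=> /enlargementP[a Aa za]; exists a => //.
          by rewrite ballEmdist /= metric_sym.
        move=> [a Aa]; rewrite ballEmdist /= => az; apply/enlargementP.
        by exists a => //; rewrite metric_sym.
      by apply: borel_open; apply: bigcup_open => a _; exact: metric_open_ball.
    * apply: measurableD; first exact: borel_ball.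
      by apply: bigcup_measurable => k _; exact: borel_ball.
    * move=> z [zr nz]; split => //; case=> k [kn Gk] zk; apply: nz.
      (* The path from [z] to [y k] to [x] to [q x] has three steps shorter than [d], and [x] lies
         in the ball of radius [r] because [r - e + d < r]. *)
      have [x [xk ox]] : exists x, mdist (iota i x) (kappa (y k)) < d /\
          mdist o (iota i x) < r - e.
        by move: k kn Gk {zk}; near: i.
      have Wx := qW _ _ xk.
      apply/enlargementP; exists (q x).
        exists x => //; split => //; rewrite ballEmdist /= -(@iotaE i).
        have := metric_triangle (iota i (p i)) o (iota i x); lra.
      have := Wq _ Wx; move: zk; rewrite ballEmdist /= -!(kappaE) => zk qx.
      have := metric_triangle (kappa z) (kappa (y k)) (kappa (q x)).
      have := metric_triangle (kappa (y k)) (iota i x) (kappa (q x)).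
      rewrite (metric_sym (kappa z) (kappa (y k))) (metric_sym (kappa (y k)) (iota i x)); lra.
- exact: subIsetl.
- by move=> x [_ /Wq]; lra.
Unshelve. all: by end_near. Qed.

End GromovToWeakApproximation.

(** * Weak approximations along a diagonal sequence *)

Section GromovToWeak.
Context {R : realType} (X : nat -> pmmSpace R) (Xoo : pmmSpace R).
Hypothesis X_bf : forall i : nat, boundedly_finite (X i).
Hypothesis Xoo_bf : boundedly_finite Xoo.

Local Notation p i := (pmm_base (X i)).
Local Notation poo := (pmm_base Xoo).
Local Notation m i := (pmm_measure (X i)).

Lemma pmG_wpmGH : pmG_cvg X Xoo -> wpmGH_cvg X Xoo.
Proof.
move=> [Y [iota [kappa [iotaE kappaE base_cvg weak_cvg]]]].
have [nu [nuE nu_fin]] := pushforward_measure Xoo_bf kappaE.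
have nu_int phi : Cbbs phi -> (\int[nu]_y (phi y)%:E)%E =
    (\int[pmm_measure Xoo]_z (phi (kappa z))%:E)%E.
  by move=> Cphi; rewrite nuE; exact: integral_pushforward_isometric.
pose T i : set (borel (X i)) := setT.
have iota_fin i := isometric_ball_finite (@X_bf i) (iotaE i).
have T_tested phi : Cbbs phi -> tested (nu := nu) T iota phi.
  move=> Cphi; have := weak_cvg _ Cphi; rewrite -nuE.
  have -> // : (fun i => (\int[pushforward (m i) (iota i : borel (X i) -> borel Y)]_y
      (phi y)%:E)%E) = (fun i => (\int[m i]_(x in T i) (phi (iota i x))%:E)%E).
  by apply/funext => i; exact: integral_pushforward_isometric.
have test_cvg phi : Cbbs phi -> (\int[m i]_x phi (iota i x))%R @[i --> \oo] -->
    (\int[pmm_measure Xoo]_z phi (kappa z))%R.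
  move=> Cphi; have -> : (\int[pmm_measure Xoo]_z phi (kappa z) =
      \int[nu]_y phi y)%R by rewrite /Rintegral nu_int.
  apply/(testedE nu_fin _ Cphi); last exact: T_tested.
  by near=> i.
(* The radius starts at 2 and the error at 1, so that [e n < r n] already holds for [n = 0]. *)
pose r n : R := n.+2%:R; pose e n : R := n.+1%:R^-1.
have er n : 0 < e n < r n.
  rewrite invr_gt0 ltr0n /=; apply: (@le_lt_trans _ _ 1); last by rewrite ltr1n.
  by rewrite invf_le1// ler1n.
have [s [s_homo s_cvg s_near]] := near_diagonal (fun n =>
  near_weak_approximation X_bf Xoo_bf iotaE kappaE base_cvg test_cvg (er n)).
have s_large M : \forall i \near \oo, M <= (s i)%:R :> R.
  exact: (s_cvg _ (nbhs_infty_ger M)).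
(* Where no approximation exists, the constant map and the empty set serve as defaults. *)
have choose_approx i : exists qA : (X i -> Xoo) * set (borel (X i)),
    (exists qA : (X i -> Xoo) * set (borel (X i)),
      close_approximation iota kappa (r (s i)) (e (s i)) qA.1 qA.2) ->
    close_approximation iota kappa (r (s i)) (e (s i)) qA.1 qA.2.
  have [[qA qAP]|no] := pselect (exists qA : (X i -> Xoo) * set (borel (X i)),
      close_approximation iota kappa (r (s i)) (e (s i)) qA.1 qA.2).
    by exists qA.
  by exists (fun=> poo, set0).
pose qA i := sval (cid (choose_approx i)).
have {s_near}approx : \forall i \near \oo,
    close_approximation iota kappa (r (s i)) (e (s i)) (qA i).1 (qA i).2.
  by apply: filterS s_near => i; exact: (svalP (cid (choose_approx i))).
have e_cvg : e (s i) @[i --> \oo] --> 0 by exact: cvg_comp s_cvg cvg_harmonic.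
exists (r \o s), (e \o s), (fun i => (qA i).1).
pose D i : set (borel (X i)) := ball (p i) (r (s i)).
have mD i : measurable (D i) by exact: borel_ball.
have D_fin (Z : polishMetricType R) (f : forall i, X i -> Z) :
    (\forall i \near \oo,
      measurable_fun (D i) (f i : borel (X i) -> borel Z)) ->
    \forall i \near \oo, ball_finite (m i) (D i) (f i).
  by apply: filterS => i; apply: ball_finite_finite => //; exact: (@X_bf i).
have mq : \forall i \near \oo, measurable_fun (D i) ((qA i).1 : borel (X i) -> borel Xoo).
  by apply: filterS approx => i [[]].
have mkq : \forall i \near \oo, measurable_fun (D i) (kappa \o (qA i).1 : borel (X i) -> borel Y).
  apply: filterS mq => i mqi.
  apply: (@measurableT_comp _ _ _ _ (borel Xoo) (borel Y)) mqi.
  by apply: continuous_borel; exact: isometric_continuous.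
split.
- split; first by move=> i j ij; rewrite ler_nat !ltnS s_homo.
  apply/cvgryPge => M; near=> i.
  have h : M <= (s i)%:R by near: i; exact: s_large.
  by apply: (le_trans h); rewrite ler_nat; lia.
- by split => // i j ij; rewrite lef_pV2 ?posrE// ler_nat ltnS s_homo.
- by apply: filterS approx => i [].
(* Inside Y the maps [kappa \o q] and [iota] are close on the good sets, so convergence passes from
   the latter to the former. *)
have q_tested Phi : Cbbs Phi -> tested (nu := nu) D (fun i => kappa \o (qA i).1) Phi.
  apply: (@tested_transfer _ _ _ _ nu_fin D T (fun i => (qA i).2)
    (fun i => kappa \o (qA i).1) iota (e \o s) (kappa poo)) => //.
  + exact: D_fin.
  + by near=> i.
  + apply: filterS approx => i [_ mA Ar close _]; split => // x /close.
    by rewrite metric_sym.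
  + move=> t; near=> i.
    have [_ mA Ar _ muA] : close_approximation iota kappa (r (s i)) (e (s i))
      (qA i).1 (qA i).2 by near: i.
    apply: le_trans muA; apply: ball_finite_setD_le => //.
    by near: i; exact: D_fin.
  + move=> t; near=> i.
    have [_ mA Ar _ muA] : close_approximation iota kappa (r (s i)) (e (s i))
      (qA i).1 (qA i).2 by near: i.
    apply: le_trans muA; apply: isometric_setD_le => //.
    have base1 : mdist (iota i (p i)) (kappa poo) < 1 by near: i; exact: near_base.
    have st : 1 + t <= (s i)%:R by near: i; exact: s_large.
    have : (s i)%:R <= r (s i) by rewrite ler_nat; lia.
    lra.
move=> phi Cphi.
(* On the limit space it suffices to test Lipschitz functions, and these extend to Y. *)
apply: (@tested_lipschitz _ X Xoo (pmm_measure Xoo) Xoo_bf D (fun i => (qA i).1)) => //.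
  exact: D_fin.
move=> k f k0 kf Cf f0.
have [Phi CPhi PhiE] := lipschitz_extension kappaE k0 kf Cf f0.
have := q_tested _ CPhi; rewrite /tested nu_int// => PhiE_cvg.
have fE : f = Phi \o kappa by apply/funext => z; rewrite /= PhiE.
by rewrite fE.
Unshelve. all: by end_near. Qed.

End GromovToWeak.

Theorem theorem12p2 (R : realType) (X : nat -> pmmSpace R) (Xoo : pmmSpace R)
    (X_bf : forall i : nat, boundedly_finite (X i))
    (Xoo_bf : boundedly_finite Xoo) :
  wpmGH_cvg X Xoo <-> pmG_cvg X Xoo.
Proof. by split; [exact: wpmGH_pmG|exact: pmG_wpmGH]. Qed.
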